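(* Assume $\|w(p)\|\le\overline v/\sqrt5$ for all $p\in\Omega$. Let $\xi_C\in\hat X\cap C^{1,1}([0,1])^2$ be a minimizer of $T$ over $\hat X$ with bounded curvature, i.e. there is $\overline\sigma<\infty$ such that $\|(\xi_C)_\tau(a)-(\xi_C)_\tau(b)\|\le\overline\sigma|a-b|$ for all $a,b\in[0,1]$. Let $L=\|(\xi_C)_\tau\|$ denote its length and let $\overline\alpha_i:=\max_{\tau\in[0,1]}\alpha_i(\xi_C(\tau))$, $i=0,1,2$, where $$\alpha_0(p)=\frac{L}{\underline v^3(p)}\big(12c_1^2(p)+4\underline v(p)c_2(p)\big),\quad \alpha_1(p)=\frac{8c_1(p)}{\underline v^2(p)},\quad \alpha_2(p)=\frac{2}{L\,\underline v(p)} .$$ Then there is a constant $r>0$ such that for all digraphs $G$ that are $(h,l)$-dense in $\Omega$ with $l\le\min\{\frac{r}{7\overline\sigma},1\}L$ and $h\le\frac{\overline\sigma l^2}{L^2}$, every shortest discrete path $\xi_G$ in $G$ (i.e. minimizer of $T$ over $X_G$) satisfies $$T(\xi_G)-T(\xi_C)\le\frac{4\overline\sigma^2l^2}{3L^2}\left(\frac{l^2}{L^2}\overline\alpha_0+5\frac{l}{L}\overline\alpha_1+23\,\overline\alpha_2\right),$$ and the right-hand side is at most $\frac{92\,\overline\sigma^2\,\overline\alpha_2}{3L^2}\,l^2+\mathcal{O}(l^3)$ as $l\to0$.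
   Context: Setting (planar flight planning, Zermelo navigation). $x_O\neq x_D$ are points in $\mathbb{R}^2$, $\overline v>0$ is a constant airspeed, and $w:\mathbb{R}^2\to\mathbb{R}^2$ is a stationary, twice continuously differentiable wind field with $\|w\|_{L^\infty(\mathbb{R}^2)}<\overline v$. $\Omega\subset\mathbb{R}^2$ is a (filled) ellipse with focal points $x_O,x_D$ in which every trajectory from $x_O$ to $x_D$ of minimal flight duration is contained. $\|\cdot\|$ is the Euclidean norm, respectively the induced operator norm. For $p\in\Omega$: $c_0(p)=\|w(p)\|$, $c_1(p)=\|w_x(p)\|$, $c_2(p)=\|w_{xx}(p)\|$, $\underline v(p)=\sqrt{\overline v^2-c_0^2(p)}$. For $p\in\Omega$ and $q\in\mathbb{R}^2$ put $$f(p,q)=\frac{-q^Tw(p)+\sqrt{(q^Tw(p))^2+(\overline v^2-w(p)^Tw(p))\,q^Tq}}{\overline v^2-w(p)^Tw(p)} .$$ For a Lipschitz path $\xi:[0,1]\to\Omega$ with a.e. derivative $\xi_\tau$, the flight duration is $T(\xi)=\int_0^1 f(\xi(\tau),\xi_\tau(\tau))\,d\tau$. It does not depend on the parametrization. $\hat X$ is the set of all $\xi\in C^{0,1}([0,1],\Omega)$ with $\xi(0)=x_O$, $\xi(1)=x_D$, and $\|\xi_\tau(\tau)\|$ equal to a constant (the path length) for almost all $\tau$. Graphs: $G=(V,E)$ is a directed graph with a finite vertex set $V\subset\mathbb{R}^2$ containing $x_O$ and $x_D$, and $E\subset V\times V$. It is $(h,l)$-dense in the convex set $\Omega$, for $h,l\ge0$,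 if (1) $V\subset\Omega$; (2) for all $p\in\Omega$ there is $v\in V$ with $\|p-v\|\le h$; (3) for all $v,v'\in V$ with $\|v-v'\|\le l+2h$ one has $(v,v')\in E$. A discrete path is a finite sequence $(x_i)_{0\le i\le n}$ in $V$ with $x_0=x_O$, $x_n=x_D$, $(x_{i-1},x_i)\in E$. It is identified with its piecewise linear interpolant $\xi(\tau)=x_{\lfloor n\tau\rfloor}+(n\tau-\lfloor n\tau\rfloor)(x_{\lceil n\tau\rceil}-x_{\lfloor n\tau\rfloor})$. $X_G$ is the set of all such paths. Convention: $r/(7\overline\sigma)=+\infty$ if $\overline\sigma=0$. *)

(* Defs.v *)
(* Points of the plane are row vectors 'rV[R]_2 over an arbitrary R : realType.
   MathComp-Analysis equips 'rV[R]_2 with the max norm `|_|; it induces the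
   usual topology and differential, but every norm below is the Euclidean
   norm [enorm] or an operator norm built from it. *)
From mathcomp Require Import all_boot all_order all_algebra.
From mathcomp Require Import all_classical all_reals all_analysis.

Set Implicit Arguments.
Unset Strict Implicit.
Unset Printing Implicit Defensive.

Import Order.TTheory GRing.Theory Num.Theory.
Import numFieldNormedType.Exports.

Local Open Scope classical_set_scope.
Local Open Scope ring_scope.

Notation plane R := 'rV[R]_2.

Section Euclidean.
Context {R : realType}.
Implicit Types p q u v : plane R.

Definition edot u v : R := \sum_(i < 2) u ord0 i * v ord0 i.

Definition enorm u : R := Num.sqrt (edot u u).

Definition filled_ellipse p q (Omega : set (plane R)) : Prop :=
  exists2 s : R, enorm (q - p) < s &
    Omega = [set x | enorm (x - p) + enorm (x - q) <= s].

Definition is_minimizer (X : Type) (F : X -> R) (S : set X) (x : X) : Prop :=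
  S x /\ forall y, S y -> F x <= F y.

End Euclidean.

Section Wind.
Context {R : realType}.
Variables (vbar : R) (w : plane R -> plane R).
Implicit Types p q u v : plane R.

Definition twice_continuously_differentiable : Prop :=
  [/\ forall p, differentiable w p,
      forall u p, differentiable ('D_u w) p &
      forall u v, continuous ('D_v ('D_u w))].

(* This is the L^infty norm of w, since w is continuous. *)
Definition sup_norm : \bar R := ereal_sup [set (enorm (w p))%:E | p in setT].

Definition c0 p : R := enorm (w p).

Definition unit_ball : set (plane R) := [set u | enorm u <= 1].

(* Operator norm of the derivative w_x(p), u |-> w_x(p) u = 'D_u w p. *)
Definition c1 p : R := sup [set enorm ('D_u w p) | u in unit_ball].

(* Operator norm of w_xx(p), seen as the bilinear map
   (u, v) |-> w_xx(p)[u, v] = 'D_v ('D_u w) p. *)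
Definition c2 p : R :=
  sup [set enorm ('D_uv.2 ('D_uv.1 w) p) | uv in unit_ball `*` unit_ball].

Definition vlow p : R := Num.sqrt (vbar ^+ 2 - c0 p ^+ 2).

Definition travel_density p q : R :=
  (- edot q (w p)
   + Num.sqrt (edot q (w p) ^+ 2 + (vbar ^+ 2 - edot (w p) (w p)) * edot q q))
  / (vbar ^+ 2 - edot (w p) (w p)).

Definition alpha0 (L : R) p : R :=
  L / vlow p ^+ 3 * (12 * c1 p ^+ 2 + 4 * vlow p * c2 p).

Definition alpha1 p : R := 8 * c1 p / vlow p ^+ 2.

Definition alpha2 (L : R) p : R := 2 / (L * vlow p).

End Wind.

Section Paths.
Context {R : realType}.
Implicit Types (xi : R -> plane R) (p q : plane R) (Omega : set (plane R)).

(* A path is a total function on R of which only the restriction to [0, 1]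
   matters. *)
Definition unit_itv : set R := `[0, 1].

(* Difference quotients with both points in [0, 1], so that the derivative is
   two-sided in ]0, 1[ and one-sided at 0 and at 1. *)
Definition diff_quotients xi (t : R) : set_system (plane R) :=
  (fun s => (s - t)^-1 *: (xi s - xi t)) @ within unit_itv t^'.

(* Meaningless where the difference quotients do not converge, which for a
   Lipschitz path is a set of measure zero. *)
Definition path_deriv xi (t : R) : plane R := lim (diff_quotients xi t).

Definition lipschitz_path (k : R) xi : Prop :=
  forall a b, unit_itv a -> unit_itv b ->
    enorm (xi a - xi b) <= k * `|a - b|.

Definition flight_duration (vbar : R) (w : plane R -> plane R) xi : R :=
  \int[lebesgue_measure]_(t in unit_itv)
    travel_density vbar w (xi t) (path_deriv xi t).

Definition trajectories p q Omega : set (R -> plane R) :=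
  [set xi | [/\ forall t, unit_itv t -> Omega (xi t),
                exists k, lipschitz_path k xi, xi 0 = p & xi 1 = q]].

Definition has_speed xi (L : R) : Prop :=
  {ae lebesgue_measure, forall t, unit_itv t -> enorm (path_deriv xi t) = L}.

(* The set \hat X; the constant speed is then the length of the path. *)
Definition constant_speed_trajectories p q Omega : set (R -> plane R) :=
  [set xi | trajectories p q Omega xi /\ exists L, has_speed xi L].

(* xi is of class C^{1,1} on [0, 1], and sigma is a Lipschitz constant of its
   derivative. *)
Definition bounded_curvature (sigma : R) xi : Prop :=
  (forall t, unit_itv t -> cvg (diff_quotients xi t)) /\
  lipschitz_path sigma (path_deriv xi).

(* The maximum of F along xi: F is continuous in the intended uses, so that
   the supremum is attained. *)
Definition max_along xi (F : plane R -> R) : R :=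
  sup [set F (xi t) | t in unit_itv].

End Paths.

Section Graphs.
Context {R : realType}.
Variables (p q : plane R).

Record digraph := Digraph {
  vertices : set (plane R);
  edges : set (plane R * plane R);
  vertices_finite : finite_set vertices;
  vertices_origin : vertices p;
  vertices_destination : vertices q;
  edges_vertices : edges `<=` vertices `*` vertices }.

Definition dense_in (h l : R) (Omega : set (plane R)) (G : digraph) : Prop :=
  [/\ 0 <= h, 0 <= l,
      vertices G `<=` Omega,
      forall x, Omega x -> exists2 v, vertices G v & enorm (x - v) <= h &
      forall v v', vertices G v -> vertices G v' ->
        enorm (v - v') <= l + 2 * h -> edges G (v, v')].

(* The sequence x_0, ..., x_n; the values x i with i > n are irrelevant. *)
Definition discrete_path (G : digraph) (n : nat) (x : nat -> plane R) : Prop :=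
  [/\ forall i, (i <= n)%N -> vertices G (x i), x 0%N = p, x n = q &
      forall i, (i < n)%N -> edges G (x i, x i.+1)].

Definition interpolant (n : nat) (x : nat -> plane R) (t : R) : plane R :=
  let lo := Num.truncn (n%:R * t) in
  let hi := `|Num.ceil (n%:R * t)|%N in
  x lo + (n%:R * t - lo%:R) *: (x hi - x lo).

Definition discrete_paths (G : digraph) : set (R -> plane R) :=
  [set xi | exists n x, discrete_path G n x /\ xi = interpolant n x].

End Graphs.

Section Bound.
Context {R : realType}.

(* r / (7 sigma), read as +oo for sigma = 0. *)
Definition curvature_ratio (r sigma : R) : \bar R :=
  if sigma == 0 then +oo%E else (r / (7 * sigma))%:E.

Definition error_bound (sigma L a0 a1 a2 l : R) : R :=
  4 * sigma ^+ 2 * l ^+ 2 / (3 * L ^+ 2)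
  * (l ^+ 2 / L ^+ 2 * a0 + 5 * (l / L) * a1 + 23 * a2).

End Bound.

(* Main.v *)
(* f(p, q) is the least t >= 0 with |q - t w(p)| <= vbar t. By compactness a
   global minimizer of the flight duration exists; it lies in Omega, and polygons
   inscribed in it show that T has the same infimum over constant-speed paths in
   Omega, so that xi_C minimizes T among all Lipschitz paths from x_O to x_D.
   If sigma = 0, then h = 0 and the finite graph would contain all of Omega.
   Otherwise let xi~ be the discrete path through vertices near equidistant
   points of xi_C. As T(xi_C) <= T(2 xi_C - xi~), the error T(xi~) - T(xi_C) is
   at most T(xi~) + T(2 xi_C - xi~) - 2 T(xi_C), the integral of a second
   difference of f; since xi~ deviates from xi_C by O(l^2) and its derivative by
   3 sigma l/L to first order, this is bounded pointwise by the alpha2 term of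
   the claim, for small l. *)
Require Import Defs.
From HB Require Import structures.
From mathcomp Require Import all_boot all_order all_algebra.
From mathcomp Require Import all_classical all_reals all_analysis.
From mathcomp Require Import measurable_realfun.
From mathcomp Require Import ring lra.

Set Implicit Arguments.
Unset Strict Implicit.
Unset Printing Implicit Defensive.

Import Order.TTheory GRing.Theory Num.Theory.
Import numFieldNormedType.Exports.

Local Open Scope classical_set_scope.
Local Open Scope ring_scope.

(** * The travel density *)

(** Minimality of [xi_C] among all Lipschitz paths matters because the reflection 2 xi_C - xi~ may
    leave [Omega] and need not have constant speed, so that minimality within \hat X says nothing
    about it. The obstacle is the derivative in T: it exists only almost everywhere, is unspecified
    elsewhere, and does not pass to pointwise limits. Hence each path is given a clock, a Lipschitz
    function whose derivative is almost everywhere the travel density, and inequalities between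
    durations become the fact that a Lipschitz function with almost everywhere nonpositive
    derivative does not increase; vectors are first paired with a test vector of norm at most 1. For
    compactness, time is made proportional to the clock, and |x' - T w(x)| <= vbar T is relaxed to
    an inequality between differences. The wind bound vbar / sqrt 5 keeps the factor g that
    amplifies the first-order deviation below 20/11, and the constant 23 suffices because 9 g^3 + 3
    g <= 184/3 for such g. The small parameter is eta = l / L; [r] is fixed last, so that the higher
    orders fit into the remaining slack. *)

Section EuclideanTheory.
Context {R : realType}.
Implicit Types u v q e : plane R.

Lemma edotE u v :
  edot u v = u ord0 ord0 * v ord0 ord0 + u ord0 ord_max * v ord0 ord_max.
Proof.
rewrite /edot big_ord_recl big_ord1; congr (_ + _ * _); congr (_ _ _);
  exact/val_inj.
Qed.

Lemma edotC u v : edot u v = edot v u.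
Proof. by rewrite !edotE; ring. Qed.

Lemma edotDl u v q : edot (u + v) q = edot u q + edot v q.
Proof. by rewrite !edotE !mxE; ring. Qed.

Lemma edotNl u q : edot (- u) q = - edot u q.
Proof. by rewrite !edotE !mxE; ring. Qed.

Lemma edotZl (a : R) u q : edot (a *: u) q = a * edot u q.
Proof. by rewrite !edotE !mxE; ring. Qed.

Lemma edotDr u v q : edot q (u + v) = edot q u + edot q v.
Proof. by rewrite !(edotC q) edotDl. Qed.

Lemma edotNr u q : edot q (- u) = - edot q u.
Proof. by rewrite !(edotC q) edotNl. Qed.

Lemma edotZr (a : R) u q : edot q (a *: u) = a * edot q u.
Proof. by rewrite !(edotC q) edotZl. Qed.

Lemma edot_ge0 u : 0 <= edot u u.
Proof. by rewrite edotE; nra. Qed.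

Lemma enorm_ge0 u : 0 <= enorm u.
Proof. exact: sqrtr_ge0. Qed.

Lemma enorm_sqr u : enorm u ^+ 2 = edot u u.
Proof. by rewrite /enorm sqr_sqrtr// edot_ge0. Qed.

Lemma enorm_sqrD u v :
  enorm (u + v) ^+ 2 = enorm u ^+ 2 + 2 * edot u v + enorm v ^+ 2.
Proof. by rewrite !enorm_sqr edotDl !edotDr (edotC v u); ring. Qed.

Lemma enorm_leP u (c : R) : 0 <= c -> (enorm u <= c) = (edot u u <= c ^+ 2).
Proof. by move=> c0; rewrite -enorm_sqr ler_sqr ?nnegrE// enorm_ge0. Qed.

Lemma edot_le u v : edot u v <= enorm u * enorm v.
Proof.
have [|uv0] := lerP (edot u v) 0.
  by move/le_trans; apply; rewrite mulr_ge0 ?enorm_ge0.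
rewrite -ler_sqr ?nnegrE ?(ltW uv0) ?mulr_ge0 ?enorm_ge0//.
rewrite exprMn !enorm_sqr !edotE; set a := u _ _; set b := u _ _.
set c := v _ _; set d := v _ _.
by have := sqr_ge0 (a * d - b * c); nra.
Qed.

Lemma ler_edot_norm u v : `|edot u v| <= enorm u * enorm v.
Proof.
rewrite ler_norml edot_le andbT lerNl -edotNl.
by rewrite (le_trans (edot_le _ _))// /enorm edotNl edotNr opprK.
Qed.

Lemma enorm0 : enorm (0 : plane R) = 0.
Proof. by rewrite /enorm edotE !mxE mulr0 addr0 sqrtr0. Qed.

Lemma enorm_eq0 u : enorm u = 0 -> u = 0.
Proof.
move=> u0; have : enorm u ^+ 2 = 0 by rewrite u0 expr0n.
rewrite enorm_sqr edotE => h.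
have a0 : u ord0 ord0 = 0 by nra.
have b0 : u ord0 ord_max = 0 by nra.
apply/rowP => i; rewrite mxE.
have [->//|/eqP i0] := eqVneq i ord0.
suff -> : i = ord_max by [].
by apply/val_inj; case: i i0 => -[|[|]]//= p /eqP.
Qed.

Lemma enormZ (a : R) u : enorm (a *: u) = `|a| * enorm u.
Proof.
rewrite /enorm edotZl edotZr mulrA -expr2 sqrtrM ?sqr_ge0//.
by rewrite sqrtr_sqr.
Qed.

Lemma enormN u : enorm (- u) = enorm u.
Proof. by rewrite /enorm edotNl edotNr opprK. Qed.

Lemma enormB u v : enorm (u - v) = enorm (v - u).
Proof. by rewrite -opprB enormN. Qed.

Lemma enormD u v : enorm (u + v) <= enorm u + enorm v.
Proof.
rewrite -ler_sqr ?nnegrE ?addr_ge0 ?enorm_ge0//.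
by rewrite enorm_sqrD sqrrD; have := edot_le u v; rewrite -mulr_natl; lra.
Qed.

Lemma enormBD u v : enorm (u - v) <= enorm u + enorm v.
Proof. by rewrite (le_trans (enormD _ _))// enormN. Qed.

Lemma enorm_tri q u v : enorm (u - v) <= enorm (u - q) + enorm (q - v).
Proof. by rewrite (_ : u - v = (u - q) + (q - v)) ?enormD// addrA subrK. Qed.

Lemma coord_le_enorm u i : `|u ord0 i| <= enorm u.
Proof.
rewrite -ler_sqr ?nnegrE ?enorm_ge0// enorm_sqr edotE (real_normK (num_real _)).
have [->|/eqP i0] := eqVneq i ord0; first by nra.
suff -> : i = ord_max by nra.
by apply/val_inj; case: i i0 => -[|[|]]//= p /eqP.
Qed.

(** The test vector is [u] itself, normalized. This reduces bounds on vectors to bounds on scalars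
    [edot e u], to which monotonicity arguments in one variable apply. *)
Lemma enorm_dual u (c : R) : 0 <= c ->
  (forall e, enorm e <= 1 -> edot e u <= c) -> enorm u <= c.
Proof.
move=> c0 h; have [u0|u0] := eqVneq (enorm u) 0; first by rewrite u0.
have up : 0 < enorm u by rewrite lt_def u0 enorm_ge0.
have := h ((enorm u)^-1 *: u).
rewrite enormZ ger0_norm ?invr_ge0 ?enorm_ge0// mulVf// => /(_ (lexx _)).
by rewrite edotZl -enorm_sqr expr2 mulrA mulVf// mul1r.
Qed.

End EuclideanTheory.

Section Density.
Context {R : realType}.
Variables (vbar : R) (w : plane R -> plane R).
Hypothesis vbar_gt0 : 0 < vbar.
Hypothesis w_lt : forall p, enorm (w p) < vbar.
Implicit Types p q : plane R.

Let vlow2_gt0 p : 0 < vbar ^+ 2 - edot (w p) (w p).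
Proof.
by rewrite -enorm_sqr subr_gt0 ltr_sqr ?nnegrE ?(ltW vbar_gt0) ?enorm_ge0.
Qed.

Let rad_ge0 p q :
  0 <= edot q (w p) ^+ 2 + (vbar ^+ 2 - edot (w p) (w p)) * edot q q.
Proof. by rewrite addr_ge0 ?sqr_ge0 ?mulr_ge0 ?(ltW (vlow2_gt0 _)) ?edot_ge0. Qed.

Lemma density_ge0 p q : 0 <= travel_density vbar w p q.
Proof.
rewrite /travel_density divr_ge0 ?(ltW (vlow2_gt0 _))//.
rewrite addrC subr_ge0 (le_trans (ler_norm _))// -sqrtr_sqr ler_wsqrtr//.
by rewrite lerDl mulr_ge0 ?(ltW (vlow2_gt0 _)) ?edot_ge0.
Qed.

(** The quadratic equation that results from squaring |q - t w(p)| = vbar t; the formula for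
    [travel_density] is its larger root. *)
Let density_root p q (t := travel_density vbar w p q) :
  (vbar ^+ 2 - edot (w p) (w p)) * t ^+ 2 + 2 * t * edot q (w p) = edot q q.
Proof.
rewrite /t /travel_density.
set D := _ - _; set b := edot q (w p); set c := edot q q.
have D0 : D != 0 by rewrite gt_eqF// /D vlow2_gt0.
have := sqr_sqrtr (rad_ge0 p q); rewrite -/D -/b -/c.
set s := Num.sqrt _ => hs.
have -> : D * ((- b + s) / D) ^+ 2 + 2 * ((- b + s) / D) * b = (s ^+ 2 - b ^+ 2) / D.
  by field.
by rewrite hs addrC addKr mulrC mulKf.
Qed.

Let level (t : R) p q : enorm (q - t *: w p) ^+ 2 =
  (edot q q - 2 * t * edot q (w p) + t ^+ 2 * edot (w p) (w p)).
Proof.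
by rewrite enorm_sqr edotDl !edotDr !edotNl !edotNr !edotZl !edotZr (edotC (w p) q);
  ring.
Qed.

Lemma density_eq p q (t := travel_density vbar w p q) :
  enorm (q - t *: w p) = vbar * t.
Proof.
have E : enorm (q - t *: w p) ^+ 2 = (vbar * t) ^+ 2.
  by rewrite level -(density_root p q) -/t; ring.
by apply: (pexpIrn _ _ _ E) => //;
  rewrite nnegrE ?enorm_ge0// mulr_ge0 ?density_ge0 ?(ltW vbar_gt0).
Qed.

Lemma density_le p q (t : R) : 0 <= t ->
  enorm (q - t *: w p) <= vbar * t -> travel_density vbar w p q <= t.
Proof.
move=> t0; rewrite -ler_sqr ?nnegrE ?enorm_ge0 ?mulr_ge0 ?(ltW vbar_gt0)//.
rewrite level -(density_root p q); set s := travel_density _ _ _ _.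
have s0 : 0 <= s by exact: density_ge0.
set D := edot (w p) (w p); set b := edot q (w p) => h.
have D0 : 0 < vbar ^+ 2 - D by exact: vlow2_gt0.
(* The difference of the quadratics at [t] and [s] factors. If [t < s], the second factor is
   positive by [h2], which is a contradiction, unless [t = 0]; then [h] forces q = 0 and hence
   [s = 0]. *)
have h1 : 0 <= (t - s) * ((vbar ^+ 2 - D) * (t + s) + 2 * b) by nra.
rewrite leNgt; apply/negP => ts.
have s1 : 0 < s by exact: le_lt_trans ts.
have h2 : (vbar ^+ 2 - D) * s + 2 * b >= 0.
  rewrite -(pmulr_rge0 _ s1); have hr := density_root p q.
  rewrite -/s -/b -/D in hr; have := edot_ge0 q; rewrite -hr.
  by congr (0 <= _); ring.
have t1 : 0 < t \/ t = 0 by move: t0; rewrite le_eqVlt => /orP[/eqP->|]; [right|left].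
case: t1 => [t1|t1].
  have : (t - s) * ((vbar ^+ 2 - D) * (t + s) + 2 * b) < 0.
    rewrite nmulr_rlt0 ?subr_lt0//.
    by have := mulr_gt0 D0 t1; move: h2; lra.
  by rewrite ltNge h1.
have qq : edot q q = 0.
  apply/eqP; rewrite eq_le edot_ge0 andbT -(density_root p q) -/s -/b.
  by move: h; rewrite t1 -/D !(mul0r, mulr0, expr0n, subr0, addr0).
have q0 : q = 0 by apply: enorm_eq0; rewrite /enorm qq sqrtr0.
have bb : b = 0 by rewrite /b q0 edotE !mxE; ring.
have hr := density_root p q; rewrite -/s -/b -/D qq bb in hr.
have : 0 < (vbar ^+ 2 - D) * s ^+ 2 by rewrite mulr_gt0// exprn_gt0.
by move: hr => /=; lra.
Qed.

(** The ground speed is at most airspeed plus wind speed, hence at most [2 * vbar]. *)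
Lemma enorm_le_density p q : enorm q <= 2 * vbar * travel_density vbar w p q.
Proof.
set t := travel_density _ _ _ _.
have t0 : 0 <= t by exact: density_ge0.
have := enormD (q - t *: w p) (t *: w p).
rewrite subrK density_eq -/t enormZ ger0_norm// => /le_trans; apply.
by have := w_lt p; nra.
Qed.

(** A head wind of strength at most [W] leaves a ground speed of at least [vbar - W]. *)
Lemma density_le_enorm (W : R) p q : enorm (w p) <= W -> W < vbar ->
  travel_density vbar w p q <= enorm q / (vbar - W).
Proof.
move=> wW Wv; have D0 : 0 < vbar - W by rewrite subr_gt0.
set t := enorm q / _.
have t0 : 0 <= t by rewrite divr_ge0 ?enorm_ge0// ltW.
apply: density_le => //.
have tq : t * (vbar - W) = enorm q by rewrite divfK// gt_eqF.
have := enormBD q (t *: w p); rewrite enormZ ger0_norm// -tq => /le_trans; apply.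
by nra.
Qed.

End Density.

(** * Lipschitz functions and almost everywhere derivatives *)

Section MonotoneDerivative.
Context {R : realType}.
Let mu := @lebesgue_measure R.
Variable h : R -> R.
Hypothesis h_nd : {homo h : x y / x <= y}.
Hypothesis h_nc : {homo (fun x => x - h x) : x y / x <= y}.

Let h_lip x y : `|h x - h y| <= `|x - y|.
Proof.
wlog xy : x y / y <= x => [hw|].
  have [/hw//|xy] := leP y x.
  by rewrite (distrC (h x)) (distrC x) hw// ltW.
have := h_nd xy; have := h_nc xy; rewrite !ger0_norm ?subr_ge0 ?h_nd//; lra.
Qed.

Let h_cont : continuous h.
Proof.
move=> x; apply/cvgrPdist_le => e e0; near=> y.
rewrite (le_trans (h_lip _ _))//; near: y.
Unshelve. all: by end_near. Qed.

Let H : cumulative R R :=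
  HB.pack h (isCumulative.Build R _ R h h_nd (right_continuousW h_cont)).

Let h' (x : R) := x - h x.
Let h'_cont : continuous h'.
Proof. by move=> x; apply: cvgB; [exact: cvg_id|exact: h_cont]. Qed.

Let H' : cumulative R R :=
  HB.pack h' (isCumulative.Build R _ R h' h_nc (right_continuousW h'_cont)).

Let nu := lebesgue_stieltjes_measure H.
Let nu' := lebesgue_stieltjes_measure H'.

Let nu_itv (G : cumulative R R) (a b : R) : a <= b ->
  lebesgue_stieltjes_measure G `]a, b] = (G b - G a)%:E.
Proof.
move=> ab; rewrite /lebesgue_stieltjes_measure /measure_extension.
rewrite measurable_mu_extE/=; last exact: is_ocitv.
by rewrite wlength_itv_bnd.
Qed.

Let nu_le A : measurable A -> (nu A <= mu A)%E.
Proof.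
move=> mA; have -> : mu A = measure_add nu nu' A.
  apply: lebesgue_measure_unique => // X /ocitvP[->|[[a b] /= ab ->]].
    by rewrite !measure0.
  rewrite [RHS]measure_addE/= /nu /nu' !nu_itv ?(ltW ab)//.
  by rewrite /lebesgue_measure nu_itv ?(ltW ab)//= /h' -EFinD; congr EFin; ring.
by rewrite measure_addE leeDl.
Qed.

(** The restriction to ]0, 1] makes the Stieltjes measure finite, as the Radon-Nikodym theorem
    requires. *)
Let D : set R := `]0, 1].
Let mD : measurable (D : set (measurableTypeR R)).
Proof. exact: measurable_itv. Qed.

Let nuD_fin : (nu D < +oo)%E.
Proof. by rewrite /nu /D nu_itv// ltry. Qed.

Let nuD : {finite_measure set (measurableTypeR R) -> \bar R} := mfrestr mD nuD_fin.

Let nuDE A : nuD A = nu (A `&` D). Proof. by []. Qed.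

Let nuD_dom : nuD `<< mu.
Proof.
apply/null_content_dominatesP => A mA A0; apply/eqP; rewrite eq_le measure_ge0 andbT.
rewrite nuDE (le_trans (nu_le _)) //; first exact: measurableI.
by rewrite -A0; apply: le_measure; rewrite ?inE//; exact: measurableI.
Qed.

(* The Stieltjes measure of [h] is dominated by Lebesgue measure because that
   of [x - h x] is nonnegative; [g] is its Radon-Nikodym density. *)
Lemma monotone_density : exists g : R -> R,
  [/\ mu.-integrable setT (EFin \o g),
      (forall x, 0 <= x <= 1 -> h x - h 0 = \int[mu]_(t in [set` `]-oo, x]]) g t)%R &
      {ae mu, forall t : R, 0 < t < 1 -> is_derive t 1 h (g t)}].
Proof.
have [f [f0 ffin fint fE]] := radon_nikodym_sigma_finite nuD_dom.
pose g : R -> R := fine \o f.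
have fg : f = EFin \o g by apply/funext => x; rewrite /= fineK.
have gint : mu.-integrable setT (EFin \o g) by rewrite -fg.
have gE x : 0 <= x <= 1 -> h x - h 0 = (\int[mu]_(t in [set` `]-oo, x]]) g t)%R.
  move=> /andP[x0 x1]; transitivity (fine (nuD [set` `]-oo, x]])).
    rewrite nuDE (_ : _ `&` _ = [set` `]0, x]]).
      by rewrite /nu nu_itv.
    apply/seteqP; split=> t /=; rewrite /D/= !in_itv/=; first by move=> [-> /andP[->]].
    by move=> /andP[-> tx]; rewrite tx (le_trans tx).
  by rewrite fE ?fg//; exact: measurable_itv.
exists g; split => //.
have gloc : locally_integrable setT g.
  exact: (open_integrable_locally openT).
have gi (y : R) : mu.-integrable [set` `]-oo, y]] (EFin \o g).
  by apply: integrableS gint => //; exact: measurable_itv.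
have := FTC1Ny gi gloc.
move=> [N [mN N0 hN]]; exists N; split => // t /= ht; apply: hN => /=.
apply: contra_not ht => ht /andP[t0 t1].
have [Fd FE] := ht; rewrite -FE derive1E.
pose F s := (\int[mu]_(t in [set` `]-oo, s]]) g t)%R.
have hF : is_derive t 1 (F \+ cst (h 0)) ('D_1 F t + 0).
  by apply: is_deriveD; exact: derivableP.
rewrite -[X in is_derive _ _ _ X]addr0; apply: near_eq_is_derive hF.
near=> s.
have : s \in `]0, 1[ by near: s; apply: near_in_itvoo; rewrite in_itv/= t0.
by rewrite in_itv/= => /andP[s0 s1]; rewrite /= /F -gE ?subrK// !ltW.
Unshelve. all: by end_near. Qed.

End MonotoneDerivative.

Lemma ae_le_Rintegral d (T : measurableType d) (R : realType)
    (mu : {measure set T -> \bar R}) (D : set T) (f1 f2 : T -> R) :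
  measurable D -> mu.-integrable D (EFin \o f1) ->
  mu.-integrable D (EFin \o f2) ->
  {ae mu, forall x, D x -> f1 x <= f2 x} ->
  \int[mu]_(x in D) f1 x <= \int[mu]_(x in D) f2 x.
Proof.
move=> mD if1 if2 [N [mN N0 hN]]; rewrite /Rintegral.
rewrite (negligible_integral mN mD if1 N0) (negligible_integral mN mD if2 N0).
apply: le_Rintegral.
- exact: measurableD.
- by apply: (integrableS mD _ _ if1); [exact: measurableD|exact: subDsetl].
- by apply: (integrableS mD _ _ if2); [exact: measurableD|exact: subDsetl].
- by move=> x [Dx Nx]; apply: contrapT => h; apply: Nx; apply: hN => /=; tauto.
Qed.

Section ScalarLipschitz.
Context {R : realType}.
Let mu := @lebesgue_measure R.
Implicit Types f : R -> R.

Definition lipschitz_fun (k : R) f :=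
  forall s t, unit_itv s -> unit_itv t -> `|f s - f t| <= k * `|s - t|.

Lemma unit_itvP (t : R) : unit_itv t <-> 0 <= t <= 1.
Proof. by rewrite /unit_itv /= in_itv. Qed.

Lemma ae_imp (P Q : R -> Prop) : (forall t, P t -> Q t) ->
  {ae mu, forall t, P t} -> {ae mu, forall t, Q t}.
Proof. by move=> PQ [N [mN N0 hN]]; exists N; split => // t /= nQ; apply: hN => /= /PQ. Qed.

Lemma ae_and (P Q : R -> Prop) : {ae mu, forall t, P t} ->
  {ae mu, forall t, Q t} -> {ae mu, forall t, P t /\ Q t}.
Proof.
move=> [N [mN N0 hN]] [M [mM M0 hM]]; exists (N `|` M); split => //.
- exact: measurableU.
- by apply: null_set_setU.
- move=> t /= nPQ; have [Pt|nPt] := pselect (P t); last by left; apply: hN.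
  by right; apply: hM => /= Qt; apply: nPQ.
Qed.

Lemma ae_neq (c : R) : {ae mu, forall t : R, t != c}.
Proof.
exists [set c]; split => //; first exact: lebesgue_measure_set1.
by move=> t /= /negP; rewrite negbK => /eqP.
Qed.

Lemma integrable_cst_itv (a b c : R) : mu.-integrable [set` `]a, b]] (EFin \o cst c).
Proof.
apply: measurable_bounded_integrable; [exact: measurable_itv| |exact: measurable_cst|].
  by rewrite /= lebesgue_measure_itv/=; case: ifP => _; rewrite ltry.
exists `|c|; split; first exact: num_real.
by move=> x cx t _ /=; exact: ltW.
Qed.

Lemma Rintegral_cst_itv (a b c : R) : a <= b ->
  \int[mu]_(t in [set` `]a, b]]) cst c t = c * (b - a).
Proof.
rewrite le_eqVlt => ab; rewrite Rintegral_cst//; congr (_ * _).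
rewrite /= lebesgue_measure_itv/= lte_fin.
by case/orP: ab => [/eqP->|->//]; rewrite ltxx subrr.
Qed.

(** Composition with [clamp] extends a function on the unit interval to the whole line and keeps it
    Lipschitz. *)
Definition clamp (x : R) := Num.max 0 (Num.min x 1).

Lemma clamp_in x : 0 <= clamp x <= 1.
Proof. by rewrite /clamp le_max lexx/= ge_max ler01/= ge_min lexx orbT. Qed.

Lemma clamp_id x : 0 <= x <= 1 -> clamp x = x.
Proof. by move=> /andP[x0 x1]; rewrite /clamp (min_idPl x1) (max_idPr x0). Qed.

Lemma clamp_mono x y : x <= y -> 0 <= clamp y - clamp x <= y - x.
Proof.
move=> xy; rewrite /clamp /Num.max /Num.min.
case: (ltP x 1) => x1; case: (ltP y 1) => y1;
  do 2?[case: ifPn => ?]; lra.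
Qed.

(** f / c is the difference of [h x] and [x - h x], and both are nondecreasing because f / c has
    slopes between -1 and 1. This brings [f] within reach of [monotone_density]. *)
Lemma lipschitz_rescale k f : lipschitz_fun k f ->
  exists2 c : R, 0 < c & exists h : R -> R,
   [/\ {homo h : x y / x <= y}, {homo (fun x => x - h x) : x y / x <= y} &
     forall x, 0 <= x <= 1 -> f x = c * (2 * h x - x)].
Proof.
(* The maximum and the summand 1 make [c] positive whatever the sign of [k]. *)
move=> flip; pose c := Num.max k 0 + 1; exists c.
  by rewrite /c ltr_wpDl// le_max lexx orbT.
have c0 : 0 < c by rewrite /c ltr_wpDl// le_max lexx orbT.
have kc : k <= c by rewrite /c (@le_trans _ _ (Num.max k 0)) ?lerDl// le_max lexx.
have fl x y : x <= y -> `|f (clamp y) - f (clamp x)| / c <= clamp y - clamp x.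
  move=> xy; rewrite ler_pdivrMr//.
  have /andP[h1 h2] := clamp_mono xy.
  rewrite (le_trans (flip _ _ _ _)) ?(ger0_norm h1)//;
    try by apply/unit_itvP; exact: clamp_in.
  by rewrite mulrC ler_wpM2l.
have fl1 x y : x <= y -> (f (clamp y) - f (clamp x)) / c <= clamp y - clamp x.
  move=> xy; rewrite (le_trans _ (fl _ _ xy))// ler_wpM2r ?invr_ge0 ?(ltW c0)//.
  exact: ler_norm.
have fl2 x y : x <= y -> - ((f (clamp y) - f (clamp x)) / c) <= clamp y - clamp x.
  move=> xy; rewrite (le_trans _ (fl _ _ xy))// -mulNr.
  by rewrite ler_wpM2r ?invr_ge0 ?(ltW c0)// -normrN ler_norm.
exists (fun x => (clamp x + f (clamp x) / c) / 2); split.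
- move=> x y xy; have := fl2 _ _ xy; rewrite mulrBl; lra.
- move=> x y xy; have := fl1 _ _ xy; have := clamp_mono xy; rewrite mulrBl; lra.
- by move=> x x01; rewrite clamp_id//; field; rewrite gt_eqF.
Qed.

Let rescale_is_derive f (c : R) (h : R -> R) (t d : R) :
  (forall x, 0 <= x <= 1 -> f x = c * (2 * h x - x)) -> 0 < t < 1 ->
  is_derive t 1 h d -> is_derive t 1 f (c * (2 * d - 1)).
Proof.
move=> hf t01 gd.
have hd : is_derive t 1 (c \*: (2 \*: h - id)) (c * (2 * d - 1)).
  by apply: is_deriveZ.
apply: near_eq_is_derive hd.
have : t \in `]0, 1[ by rewrite in_itv.
move/near_in_itvoo; apply: filterS => s; rewrite in_itv/= => /andP[s0 s1].
by rewrite hf//= !ltW.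
Qed.

(** Rademacher's theorem in one variable. The measurable representative of the derivative is what
    the clock of a path is built from. *)
Lemma lipschitz_ae_derivable k f : lipschitz_fun k f ->
  exists g : R -> R, measurable_fun setT g /\
    {ae mu, forall t : R, 0 < t < 1 -> is_derive t 1 f (g t)}.
Proof.
move=> /lipschitz_rescale[c c0 [h [h1 h2 hf]]].
have [g [gi _ gd]] := monotone_density h1 h2.
exists (fun t => c * (2 * g t - 1)); split.
  have mg : measurable_fun setT g by apply/measurable_EFinP; exact: (measurable_int mu).
  apply: measurable_funM => //; apply: measurable_funB => //.
  exact: measurable_funM.
apply: ae_imp gd => t /= gd t01; have {}gd := gd t01.
exact: (rescale_is_derive hf t01 gd).
Qed.

(** By absolute continuity an increment is the integral of the derivative; a nonpositive slope of
    [f] is a slope of at most 1/2 of [h]. The comparisons of durations below rest on this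
    principle. *)
Lemma lipschitz_nonincreasing k f a b : lipschitz_fun k f ->
  0 <= a -> a <= b -> b <= 1 ->
  {ae mu, forall t : R, a < t < b -> exists2 d, is_derive t 1 f d & d <= 0} ->
  f b <= f a.
Proof.
move=> /lipschitz_rescale[c c0 [h [h1 h2 hf]]] a0 ab b1 hd.
have [g [gi gI gd]] := monotone_density h1 h2.
have gi' (D : set (measurableTypeR R)) : measurable D -> mu.-integrable D (EFin \o g).
  by move=> mD; apply: integrableS gi.
have E : h b - h a = \int[mu]_(t in [set` `]a, b]]) g t.
  rewrite -(Rintegral_itvB (a := -oo%O) (b := BRight b)) ?bnd_simp//; last first.
    by apply: gi'; exact: measurable_itv.
  by rewrite -!gI ?(le_trans _ ab) ?b1 ?a0 ?(le_trans ab) //; ring.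
have hab : h b - h a <= 2^-1 * (b - a).
  rewrite E (_ : 2^-1 * (b - a) = \int[mu]_(t in [set` `]a, b]]) (cst 2^-1) t).
    apply: ae_le_Rintegral.
    - exact: measurable_itv.
    - by apply: gi'; exact: measurable_itv.
    - exact: integrable_cst_itv.
    (* The right end point belongs to the domain of integration but is not covered by [hd]; it is
       discarded as a null set. *)
    apply: ae_imp (ae_and (ae_and gd (ae_neq b)) hd) => t /= [[gt tb] ht].
    rewrite in_itv/= => /andP[at_ tb'].
    have tb2 : t < b by rewrite lt_neqAle tb.
    have t01 : 0 < t < 1 by rewrite (le_lt_trans a0)//= (lt_le_trans tb2).
    have {}gt := gt t01.
    have fd := rescale_is_derive hf t01 gt.
    have [|d hd1 d0] := ht; first by rewrite at_ tb2.
    have Ed : d = c * (2 * g t - 1).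
      by rewrite -(@derive_val _ _ _ _ _ _ _ hd1) (@derive_val _ _ _ _ _ _ _ fd).
    move: d0; rewrite Ed pmulr_rle0//.
    by move: (g t) => z; lra.
  by rewrite Rintegral_cst_itv.
rewrite !hf ?a0 ?b1 ?(le_trans _ b1) ?(le_trans a0)// ler_wpM2l ?(ltW c0)//.
by lra.
Qed.
End ScalarLipschitz.

Section PathDerivative.
Context {R : realType}.
Implicit Types (y : R -> plane R) (d e : plane R) (t : R).

Lemma ord2P (P : 'I_2 -> Prop) : P ord0 -> P ord_max -> forall i, P i.
Proof.
move=> P0 P1 i; have [->//|/eqP i0] := eqVneq i ord0.
suff -> : i = ord_max by [].
by apply/val_inj; case: i i0 => -[|[|]]//= p /eqP.
Qed.

Lemma is_derive_coordP y d t : is_derive t 1 y d <->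
  forall i, is_derive t 1 (fun s => y s ord0 i) (d ord0 i).
Proof.
split=> [[yd <-] i|h].
  rewrite derive_mx// mxE; apply: derivableP.
  exact: (derivable_mxP _ _ _).1.
have yd : derivable y t 1.
  by apply/derivable_mxP => i j; rewrite (ord1 i); have [] := h j.
apply: DeriveDef => //; rewrite derive_mx//.
by apply/rowP => j; rewrite !mxE; have [_ <-] := h j.
Qed.

Lemma is_derive_edot y d t e : is_derive t 1 y d ->
  is_derive t 1 (fun s => edot e (y s)) (edot e d).
Proof.
move=> /is_derive_coordP yd; rewrite edotE.
have -> : (fun s => edot e (y s)) = (e ord0 ord0 \*: (fun s => y s ord0 ord0)
    + e ord0 ord_max \*: (fun s => y s ord0 ord_max)).
  by apply/funext => s; rewrite edotE.
apply: is_deriveD.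
Qed.

(** The restriction to the unit interval is invisible near an interior point, so [path_deriv] agrees
    there with the usual derivative. *)
Lemma diff_quotients_interior y t : 0 < t < 1 ->
  diff_quotients y t = (fun h => h^-1 *: ((y \o shift t) (h *: 1) - y t)) @ 0^'.
Proof.
move=> t01; have nI : \forall s \near t, unit_itv s.
  have : t \in `]0, 1[ by rewrite in_itv.
  move/near_in_itvoo; apply: filterS => s; rewrite in_itv/= => /andP[s0 s1].
  by apply/unit_itvP; rewrite !ltW.
have E (h s : R) : s = h + t ->
    (s - t)^-1 *: (y s - y t) = h^-1 *: ((y \o shift t) (h *: 1) - y t).
  by move=> ->; rewrite addrK /= [h *: 1]mulr1.
apply/seteqP; split => A.
  rewrite /diff_quotients/= /nbhs/= /within/= => hA.
  have : \forall s \near t, s != t -> A ((s - t)^-1 *: (y s - y t)).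
    by apply: filterS2 nI hA => s Is h st; apply: h.
  rewrite (near_shift 0 t) subr0; apply: filterS => h /= hh h0.
  by rewrite -(E h (h + t)) //; apply: hh; rewrite -subr_eq0 addrK.
move=> hA.
have {}hA : \forall h \near (0 : R), h != 0 ->
  A (h^-1 *: ((y \o shift t) (h *: 1) - y t)) := hA.
have : \forall s \near t, s != t -> A ((s - t)^-1 *: (y s - y t)).
  rewrite (near_shift 0 t) subr0; apply: filterS hA => h /= hh h0.
  by rewrite (E h) //; apply: hh; move: h0; rewrite -subr_eq0 addrK.
by apply: filterS => s hs st _; exact: hs.
Qed.


Lemma path_deriv_interior y t : 0 < t < 1 -> path_deriv y t = 'D_1 y t.
Proof. by move=> t01; rewrite /path_deriv diff_quotients_interior. Qed.

Lemma is_derive_path_deriv y t : 0 < t < 1 -> cvg (diff_quotients y t) ->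
  is_derive t 1 y (path_deriv y t).
Proof.
move=> t01; rewrite (path_deriv_interior _ t01) (diff_quotients_interior _ t01).
by move=> yd; apply: DeriveDef.
Qed.

Lemma path_deriv_is_derive y t d : 0 < t < 1 -> is_derive t 1 y d ->
  path_deriv y t = d.
Proof. by move=> t01 [yd <-]; exact: path_deriv_interior. Qed.

End PathDerivative.

(** * Integrals of possibly non-measurable functions *)

Section IntegralNonMeasurable.
Local Open Scope ereal_scope.
Context d (T : measurableType d) (R : realType) (mu : {measure set T -> \bar R}).
Implicit Types (D N : set T) (f g : T -> \bar R).

(* The integral of a nonnegative function is a supremum over simple functions,
   so that monotonicity needs no measurability. *)
Lemma ge0_le_integral_sup D f g : (forall x, D x -> 0 <= f x) ->
  (forall x, D x -> f x <= g x) ->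
  \int[mu]_(x in D) f x <= \int[mu]_(x in D) g x.
Proof.
move=> f0 fg; have g0 x : D x -> 0 <= g x.
  by move=> Dx; rewrite (le_trans (f0 _ Dx)) ?fg.
rewrite !ge0_integralE//; apply: ereal_sup_le => _ [h/= hf <-].
exists h => // x; rewrite (le_trans (hf x))// !patchE.
by case: ifPn => // /set_mem; exact: fg.
Qed.

(** The integrand of [flight_duration] is unspecified where a path has no derivative, so its
    measurability is not at hand. It is squeezed between the two measurable modifications of [g]
    that take the values 0 and +oo on the null set [N]. *)
Lemma ge0_integral_ae_eq D N f g : measurable D -> measurable N -> mu N = 0 ->
  measurable_fun D g -> (forall x, D x -> 0 <= f x) ->
  (forall x, D x -> 0 <= g x) -> (forall x, D x -> ~ N x -> f x = g x) ->
  \int[mu]_(x in D) f x = \int[mu]_(x in D) g x.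
Proof.
move=> mD mN N0 mg f0 g0 fg.
have gN (c : \bar R) : 0 <= c -> \int[mu]_(x in D) (if x \in N then c else g x) =
    \int[mu]_(x in D) g x.
  move=> c0; apply: ge0_ae_eq_integral => //.
  - apply: measurable_fun_if => //.
      apply: (measurable_fun_bool true); rewrite (_ : _ @^-1` [set true] = N); last first.
        by apply/seteqP; split=> x /=; [move=> /set_mem|move=> /mem_set].
      exact: measurableI.
    exact: measurable_funS mg.
  - by move=> x Dx; case: ifPn => // _; exact: g0.
  - exists N; split => // x /= h; apply: contrapT => Nx; apply: h => _.
    by rewrite memNset.
apply/eqP; rewrite eq_le; apply/andP; split.
  rewrite -(gN +oo)//; apply: ge0_le_integral_sup => // x Dx.
  case: (boolP (x \in N)) => [_|xN]; first by rewrite leey.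
  by rewrite fg// => Nx; rewrite (mem_set Nx) in xN.
rewrite -(gN 0)//; apply: ge0_le_integral_sup => // x Dx.
  by case: ifPn => // _; exact: g0.
case: (boolP (x \in N)) => [_|xN]; first exact: f0.
by rewrite fg// => Nx; rewrite (mem_set Nx) in xN.
Qed.

End IntegralNonMeasurable.

Section DerivativeBound.
Context {R : realType}.

(** The quadratic error disappears in the limit of the right difference quotients. This is how the
    differential inclusion is recovered from [admissible]. *)
Lemma is_derive_le_right (f : R -> R) (t d c C del : R) : is_derive t 1 f d ->
  0 < del ->
  (forall s, t < s -> s < t + del -> f s - f t <= c * (s - t) + C * (s - t) ^+ 2) ->
  d <= c.
Proof.
move=> [fd <-] del0 hf.
have h1 : h^-1 *: ((f \o shift t) (h *: 1) - f t) @[h --> 0^'+] --> 'D_1 f t.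
  move=> A /fd /nbhs_ballP [_ /posnumP[e] he]; exists e%:num => //= h.
  by move=> xh /gt_eqF/negbT/he; exact.
have h2 : c + C * h @[h --> 0^'+] --> c + C * (0 : R).
  apply: cvg_within_filter; apply: cvgD; first exact: cvg_cst.
  by apply: cvgM; [exact: cvg_cst|exact: cvg_id].
rewrite -[leRHS]addr0 -(mulr0 C).
apply: ler_cvg_to h1 h2 _; near=> h.
have h0 : 0 < h by near: h; exact: nbhs_right_gt.
rewrite /= [h *: 1]mulr1 [_ *: _]mulrC ler_pdivrMr//.
have := hf (h + t); rewrite addrK ltrDr h0 => /(_ isT) hh.
have hd : h < del by near: h; exact: nbhs_right_lt.
by apply: le_trans (hh _) _; [lra|nra].
Unshelve. all: by end_near. Qed.

Lemma lipschitz_path_edot (k : R) (y : R -> plane R) e : lipschitz_path k y ->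
  lipschitz_fun (enorm e * k) (fun s => edot e (y s)).
Proof.
move=> hy s t s1 t1; rewrite -edotNr -edotDr.
rewrite (le_trans (ler_edot_norm _ _))// -mulrA ler_wpM2l ?enorm_ge0//.
exact: hy.
Qed.

Lemma lipschitz_path_coord (k : R) (y : R -> plane R) i : lipschitz_path k y ->
  lipschitz_fun k (fun s => y s ord0 i).
Proof.
move=> hy s t s1 t1; apply: le_trans (hy _ _ s1 t1).
by have := coord_le_enorm (y s - y t) i; rewrite !mxE.
Qed.

Lemma lipschitz_path_ge0 (k : R) (y : R -> plane R) : lipschitz_path k y -> 0 <= k.
Proof.
move=> /(_ 1 0); rewrite subr0 normr1 mulr1 => h.
apply: (le_trans (enorm_ge0 (y 1 - y 0))); apply: h; apply/unit_itvP; rewrite ?lexx ?ler01//.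
Qed.

Lemma lipschitz_path_derive_le (k : R) (y : R -> plane R) (t : R) d : lipschitz_path k y ->
  0 < t < 1 -> is_derive t 1 y d -> enorm d <= k.
Proof.
move=> hy /andP[t0 t1] yd; have k0 := lipschitz_path_ge0 hy.
apply: enorm_dual => // e e1.
have hyd := is_derive_edot e yd.
apply: (is_derive_le_right (C := 0) (del := 1 - t) hyd); first by lra.
move=> s ts s1; rewrite mul0r addr0 (le_trans (ler_norm _))//.
rewrite (le_trans (lipschitz_path_edot e hy _ _))//; try (apply/unit_itvP; lra).
rewrite gtr0_norm ?subr_gt0// ler_wpM2r ?subr_ge0 ?(ltW ts)//.
by rewrite -[leRHS]mul1r ler_wpM2r.
Qed.

End DerivativeBound.

(** * Existence of a global minimizer *)

Section Clock.
Context {R : realType}.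
Let mu := @lebesgue_measure R.
Variables (vbar W : R) (w : plane R -> plane R).
Hypothesis vbar_gt0 : 0 < vbar.
Hypothesis w_le : forall p, enorm (w p) <= W.
Hypothesis W_lt : W < vbar.
Hypothesis w_cont : continuous w.

Let w_lt p : enorm (w p) < vbar.
Proof. exact: le_lt_trans W_lt. Qed.

Definition mkplane (a b : R) : plane R := \row_i (if i == ord0 then a else b).

Lemma clamp_continuous : continuous (clamp : R -> R).
Proof.
have clamp_lip x y : `|clamp x - clamp y| <= `|x - y| :> R.
  have [xy|/ltW xy] := leP y x.
    by have /andP[h1 h2] := clamp_mono xy; rewrite (ger0_norm h1) ger0_norm ?subr_ge0.
  have /andP[h1 h2] := clamp_mono xy.
  by rewrite distrC (distrC x) (ger0_norm h1) ger0_norm ?subr_ge0.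
move=> x; apply/cvgrPdist_le => e e0; near=> y.
by rewrite (le_trans (clamp_lip _ _))//; near: y.
Unshelve. all: by end_near. Qed.

Lemma lipschitz_path_continuous k (y : R -> plane R) : lipschitz_path k y ->
  continuous (y \o clamp).
Proof.
move=> hy x; have k0 := lipschitz_path_ge0 hy.
apply/cvgrPdist_lt => e e0.
have e1 : 0 < e / (k + 1) by rewrite divr_gt0// ltr_wpDl.
have := @clamp_continuous x => /cvgrPdist_lt /(_ _ e1); apply: filterS => z hz.
have hE : enorm (y (clamp x) - y (clamp z)) < e.
  apply: (le_lt_trans (hy _ _ _ _)); try (by apply/unit_itvP; exact: clamp_in).
  apply: (@le_lt_trans _ _ ((k + 1) * `|clamp x - clamp z|)).
    by rewrite ler_wpM2r// lerDl.
  by rewrite mulrC -ltr_pdivlMr// ltr_wpDl.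
rewrite [`|_|]mx_normrE; apply/bigmax_ltP; split => // -[i j] _ /=.
by rewrite (ord1 i); exact: le_lt_trans (coord_le_enorm _ _) hE.
Qed.


(** [tau] is the elapsed flight time. In this form durations can be compared through
    [lipschitz_nonincreasing]. *)
Lemma clock k (y : R -> plane R) : lipschitz_path k y ->
  exists (K : R) (tau : R -> R), [/\ lipschitz_fun K tau, tau 0 = 0,
    tau 1 = flight_duration vbar w y &
    {ae mu, forall t : R, 0 < t < 1 -> is_derive t 1 y (path_deriv y t) /\
      is_derive t 1 tau (travel_density vbar w (y t) (path_deriv y t))}].
Proof.
move=> hy.
have [g0 [mg0 dg0]] := lipschitz_ae_derivable (lipschitz_path_coord ord0 hy).
have [g1 [mg1 dg1]] := lipschitz_ae_derivable (lipschitz_path_coord ord_max hy).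
pose F0 t := travel_density vbar w (y (clamp t)) (mkplane (g0 t) (g1 t)).
pose M := k / (vbar - W).
have mF0 : measurable_fun setT F0.
  have yc : continuous (w \o (y \o clamp)).
    move=> t; apply: continuous_comp; last exact: w_cont.
    exact: (lipschitz_path_continuous hy).
  have cc (i : 'I_2) : continuous (fun t => w (y (clamp t)) ord0 i).
    by move=> t; apply: (@continuous_comp _ _ _ (w \o (y \o clamp)) (fun u : plane R => u ord0 i));
      [exact: yc|exact: coord_continuous].
  have mc (i : 'I_2) : measurable_fun setT (fun t => w (y (clamp t)) ord0 i).
    exact: continuous_measurable_fun.
  pose c0 t := w (y (clamp t)) ord0 ord0; pose c1 t := w (y (clamp t)) ord0 ord_max.
  pose B t := g0 t * c0 t + g1 t * c1 t.
  pose D t := vbar ^+ 2 - (c0 t * c0 t + c1 t * c1 t).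
  have -> : F0 = fun t =>
      (- B t + Num.sqrt (B t ^+ 2 + D t * (g0 t * g0 t + g1 t * g1 t))) * (D t)^-1.
    by apply/funext => t; rewrite /F0 /travel_density !edotE !mxE.
  have mB : measurable_fun setT B.
    by apply: measurable_funD; apply: measurable_funM => //; exact: mc.
  have mD : measurable_fun setT D.
    apply: measurable_funB => //.
    by apply: measurable_funD; apply: measurable_funM => //; exact: mc.
  have D0 t : D t != 0.
    rewrite /D -edotE gt_eqF// -enorm_sqr subr_gt0 ltr_sqr ?nnegrE ?enorm_ge0//.
    exact: ltW.
  apply: measurable_funM.
    apply: measurable_funD; first exact: measurableT_comp.
    pose G t := B t ^+ 2 + D t * (g0 t * g0 t + g1 t * g1 t).
    have mG : measurable_fun setT G; last first.
      rewrite -[X in measurable_fun _ X]/((@Num.sqrt R) \o G).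
      apply: measurableT_comp => //.
      exact: (continuous_measurable_fun (@sqrt_continuous R)).
    apply: measurable_funD; first exact: measurable_funX.
    apply: measurable_funM => //.
    by apply: measurable_funD; exact: measurable_funM.
  apply: continuous_measurable_fun => t.
  apply: cvgV; first exact: D0.
  apply: cvgB; first exact: cvg_cst.
  by apply: cvgD; apply: cvgM; exact: cc.
have M0 : 0 <= M.
  by rewrite divr_ge0 ?(lipschitz_path_ge0 hy)// subr_ge0 ltW.
pose I : set R := `]0, 1[%classic.
have mI : measurable I by exact: measurable_itv.
(* The cap [M] makes [F] bounded everywhere, hence [tau] Lipschitz; almost everywhere it changes
   nothing, since the derivative of [y] has norm at most [k]. The value 0 outside ]0, 1[ gives
   [tau 0 = 0]. *)
pose F t : R := if t \in I then Num.min (F0 t) M else 0.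
have F_ge0 t : 0 <= F t.
  by rewrite /F; case: ifPn => // _; rewrite le_min M0 density_ge0.
have FM t : F t <= M by rewrite /F; case: ifPn => // _; rewrite ge_min lexx orbT.
have mF : measurable_fun setT F.
  apply: measurable_fun_ifT => //; last exact: measurable_minr.
  apply: (measurable_fun_bool true); rewrite setTI (_ : _ @^-1` [set true] = I)//.
  by apply/seteqP; split=> x /=; [move=> /set_mem|move=> /mem_set].
have iF : mu.-integrable setT (EFin \o F).
  have -> : EFin \o F = (EFin \o F) \_ I.
    apply/funext => t; rewrite patchE; case: ifPn => // tI.
    by rewrite /= /F (negbTE tI).
  rewrite -integrable_mkcond//; apply: measurable_bounded_integrable => //.
  - by rewrite /= /I lebesgue_measure_itv/=; case: ifP => _; rewrite ltry.
  - exact: measurable_funS mF.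
  - exists M; split; first exact: num_real.
    by move=> x Mx t _ /=; rewrite ger0_norm// (le_trans (FM t))// ltW.
have iF' (D : set (measurableTypeR R)) : measurable D -> mu.-integrable D (EFin \o F).
  by move=> mD; apply: integrableS iF.
have key : {ae mu, forall t : R, 0 < t < 1 -> is_derive t 1 y (path_deriv y t) /\
    travel_density vbar w (y t) (path_deriv y t) = F t}.
  apply: ae_imp (ae_and dg0 dg1) => t [h0 h1] t01.
  have yd : is_derive t 1 y (mkplane (g0 t) (g1 t)).
    apply/is_derive_coordP; apply: ord2P; rewrite mxE/=; [exact: h0|exact: h1].
  rewrite (path_deriv_is_derive t01 yd); split => //.
  rewrite /F mem_set /I/= ?in_itv//= /F0 clamp_id; last by case/andP: t01 => *; rewrite !ltW.
  apply/esym/min_idPl; apply: (le_trans (density_le_enorm _ w_lt _ (w_le _) W_lt)) => //.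
  rewrite ler_wpM2r ?invr_ge0 ?subr_ge0 ?(ltW W_lt)//.
  exact: lipschitz_path_derive_le yd.
pose tau x : R := \int[mu]_(t in [set` `]-oo, x]]) F t.
have tauB a b : a <= b -> tau b - tau a = \int[mu]_(t in [set` `]a, b]]) F t.
  move=> ab; rewrite -(Rintegral_itvB (a := -oo%O) (b := BRight b)) ?bnd_simp//.
  by apply: iF'; exact: measurable_itv.
have tau0 : tau 0 = 0.
  rewrite /tau; transitivity (\int[mu]_(t in [set` `]-oo, (0:R)]]) cst 0 t).
    apply: eq_Rintegral => t; rewrite inE/= in_itv/= => t0.
    by rewrite /F memNset// /I/= in_itv/= => /andP[]; rewrite ltNge t0.
  by rewrite /Rintegral integral0.
exists M, tau; split => //.
- move=> s t _ _; wlog st : s t / t <= s => [hw|].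
    by have [/hw//|/ltW/hw] := leP t s; rewrite distrC (distrC t).
  rewrite tauB// ger0_norm; last by apply: Rintegral_ge0.
  rewrite ger0_norm ?subr_ge0//.
  apply: (@le_trans _ _ (\int[mu]_(t in [set` `]t, s]]) cst M t)).
    apply: le_Rintegral; [exact: measurable_itv| |exact: integrable_cst_itv|by []].
    by apply: iF'; exact: measurable_itv.
  by rewrite Rintegral_cst_itv.
- have -> : tau 1 = tau 1 - tau 0 by rewrite tau0 subr0.
  rewrite tauB//.
  rewrite (Rintegral_itv_obnd_cbnd (r := 0) (b := BRight 1)); last first.
    by apply: iF'; exact: measurable_itv.
  rewrite /flight_duration /Rintegral; congr fine; apply/esym.
  have [N [mN N0 hN]] := ae_and (ae_and key (ae_neq 0)) (ae_neq 1).
  apply: (@ge0_integral_ae_eq _ _ _ _ _ N) => //.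
  - exact: measurable_itv.
  - by apply/measurable_EFinP; exact: measurable_funS mF.
  - by move=> x _; rewrite lee_fin density_ge0.
  - by move=> x _; rewrite lee_fin.
  - move=> x /unit_itvP/andP[x0 x1] Nx; congr EFin.
    have [[h1 h2] h3] : ((0 < x < 1 -> is_derive x 1 y (path_deriv y x) /\
        travel_density vbar w (y x) (path_deriv y x) = F x) /\ x != 0) /\ x != 1.
      by apply: contrapT => h; apply: Nx; exact: hN.
    by apply: (h1 _).2; rewrite !lt_neqAle x0 x1 h3 eq_sym h2.
have gloc : locally_integrable setT F.
  exact: (open_integrable_locally openT).
have gi (x : R) : mu.-integrable [set` `]-oo, x]] (EFin \o F).
  by apply: iF'; exact: measurable_itv.
apply: ae_imp (ae_and key (FTC1Ny gi gloc)) => t [h1 [h2 h3]] t01.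
have [h4 h5] := h1 t01; split => //.
by rewrite h5 -h3 derive1E; exact: derivableP.
Qed.

End Clock.

(** * Reparametrization by flight time *)

Section Existence.
Context {R : realType}.
Let mu := @lebesgue_measure R.
Variables (vbar W : R) (w : plane R -> plane R).
Hypothesis vbar_gt0 : 0 < vbar.
Hypothesis w_le : forall p, enorm (w p) <= W.
Hypothesis W_lt : W < vbar.
Hypothesis w_cont : continuous w.

Let w_lt p : enorm (w p) < vbar.
Proof. exact: le_lt_trans W_lt. Qed.

(* The paths flown in time [T] at constant rate, relaxed by a quadratic error.
   Unlike the differential inclusion [enorm (x' - T w(x)) <= vbar T], this
   condition mentions no derivative and hence passes to pointwise limits. *)
Definition admissible (C T : R) (x : R -> plane R) : Prop :=
  forall s t, 0 <= s -> s <= t -> t <= 1 ->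
    enorm (x t - x s) <= 2 * vbar * T * (t - s) /\
    enorm (x t - x s - (T * (t - s)) *: w (x s))
      <= vbar * T * (t - s) + C * (t - s) ^+ 2.

Lemma lipschitz_fun_lin (k1 k2 : R) f g (a : R) : lipschitz_fun k1 f ->
  lipschitz_fun k2 g -> lipschitz_fun (k1 + `|a| * k2) (fun t : R => f t - a * g t).
Proof.
move=> hf hg s t s1 t1.
have -> : f s - a * g s - (f t - a * g t) = (f s - f t) - a * (g s - g t) by ring.
rewrite (le_trans (ler_normB _ _))// mulrDl lerD ?hf//.
by rewrite normrM -mulrA ler_wpM2l// hg.
Qed.

Lemma is_derive_lin (f g : R -> R) (t a d1 d2 : R) : is_derive t 1 f d1 ->
  is_derive t 1 g d2 -> is_derive t 1 (fun t => f t - a * g t) (d1 - a * d2).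
Proof.
move=> hf hg; have -> : (fun t => f t - a * g t) = f - a \*: g by [].
exact: is_deriveB.
Qed.

Lemma lipschitz_fun_continuous (k1 : R) f : lipschitz_fun k1 f ->
  continuous (f \o clamp).
Proof.
move=> hf x; have k0 : 0 <= k1.
  have := hf 1 0; rewrite subr0 normr1 mulr1 => h.
  by apply: le_trans (h _ _); rewrite ?normr_ge0//; apply/unit_itvP; rewrite lexx ler01.
apply/cvgrPdist_lt => e e0.
have e1 : 0 < e / (k1 + 1) by rewrite divr_gt0// ltr_wpDl.
have := @clamp_continuous R x => /cvgrPdist_lt /(_ _ e1); apply: filterS => z hz.
apply: (le_lt_trans (hf _ _ _ _)); try (by apply/unit_itvP; exact: clamp_in).
apply: (@le_lt_trans _ _ ((k1 + 1) * `|clamp x - clamp z|)).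
  by rewrite ler_wpM2r// lerDl.
by rewrite mulrC -ltr_pdivlMr// ltr_wpDl.
Qed.

Section Reparametrization.
Variables (k : R) (y : R -> plane R).
Hypothesis y_lip : lipschitz_path k y.
Variables (Kt : R) (tau : R -> R).
Hypothesis tau_lip : lipschitz_fun Kt tau.
Hypothesis tau_der : {ae mu, forall t : R, 0 < t < 1 ->
  is_derive t 1 y (path_deriv y t) /\
  is_derive t 1 tau (travel_density vbar w (y t) (path_deriv y t))}.

(** For [e] of norm at most 1, [edot e (y t) - 2 * vbar * tau t] has a nonpositive derivative by
    [enorm_le_density]. The choice [e = 0] shows that [tau] is monotone. *)
Lemma clock_speed s t : 0 <= s -> s <= t -> t <= 1 ->
  enorm (y t - y s) <= 2 * vbar * (tau t - tau s).
Proof.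
move=> s0 st t1.
have h e : enorm e <= 1 -> edot e (y t) - 2 * vbar * tau t <= edot e (y s) - 2 * vbar * tau s.
  move=> e1.
  apply: (lipschitz_nonincreasing
    (lipschitz_fun_lin (2 * vbar) (lipschitz_path_edot e y_lip) tau_lip)) => //.
  apply: ae_imp tau_der => r hr /andP[sr rt].
  have r01 : 0 < r < 1 by rewrite (le_lt_trans s0)//= (lt_le_trans rt).
  have [h1 h2] := hr r01.
  exists (edot e (path_deriv y r) - 2 * vbar * travel_density vbar w (y r) (path_deriv y r)).
    exact: is_derive_lin (is_derive_edot e h1) h2.
  rewrite subr_le0 (le_trans (edot_le _ _))//.
  rewrite (le_trans _ (enorm_le_density vbar_gt0 w_lt _ _))//.
  by rewrite -[leRHS]mul1r ler_wpM2r// enorm_ge0.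
have tau_le : tau s <= tau t.
  have := h 0; rewrite enorm0 ler01 => /(_ isT).
  by rewrite !edotE !mxE !mul0r !addr0 !sub0r lerN2 ler_pM2l// mulr_gt0.
apply: enorm_dual; first by rewrite !mulr_ge0 ?subr_ge0// ltW.
by move=> e e1; have := h e e1; rewrite edotDr edotNr; lra.
Qed.

Variable K : R.
Hypothesis K_ge0 : 0 <= K.
Hypothesis wK : forall r s, 0 <= r <= 1 -> 0 <= s <= 1 ->
  enorm (w (y r) - w (y s)) <= K * enorm (y r - y s).

(** In direction [e] the velocity at time [r] is at most f times (vbar + e.w(y r)), and w(y r)
    differs from w(y s) by at most [K] times the distance covered, which [clock_speed] bounds by 2
    vbar times the elapsed flight time. This is the origin of the quadratic error in
    [admissible]. *)
Lemma clock_inclusion s t : 0 <= s -> s <= t -> t <= 1 ->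
  enorm (y t - y s - (tau t - tau s) *: w (y s)) <=
    vbar * (tau t - tau s) + 2 * vbar * K * (tau t - tau s) ^+ 2.
Proof.
move=> s0 st t1; pose D := tau t - tau s; pose A := vbar + K * (2 * vbar * D).
have tau_le a b : 0 <= a -> a <= b -> b <= 1 -> tau a <= tau b.
  move=> a0 ab b1; have := clock_speed a0 ab b1.
  move/(le_trans (enorm_ge0 _)); rewrite pmulr_rge0 ?subr_ge0//.
  by rewrite mulr_gt0.
have D0 : 0 <= D by rewrite subr_ge0 tau_le.
have A0 : 0 <= A by rewrite addr_ge0 ?mulr_ge0// ltW.
apply: enorm_dual.
  by rewrite addr_ge0 ?mulr_ge0 ?exprn_ge0 ?subr_ge0 ?tau_le// ltW.
move=> e e1; rewrite !edotDr !edotNr edotZr.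
pose a := edot e (w (y s)) + A.
suff : edot e (y t) - a * tau t <= edot e (y s) - a * tau s by rewrite /a /A /D; nra.
apply: (lipschitz_nonincreasing
    (lipschitz_fun_lin a (lipschitz_path_edot e y_lip) tau_lip)) => //.
apply: ae_imp tau_der => r hr /andP[sr rt].
have r01 : 0 < r < 1 by rewrite (le_lt_trans s0)//= (lt_le_trans rt).
have [h1 h2] := hr r01.
set f := travel_density _ _ _ _ in h2; set d := path_deriv _ _ in h1 f h2 *.
have f0 : 0 <= f by exact: density_ge0.
exists (edot e d - a * f); first exact: is_derive_lin (is_derive_edot e h1) h2.
have e2 : edot e (d - f *: w (y r)) <= vbar * f.
  rewrite (le_trans (edot_le _ _))// density_eq//.
  by rewrite -[leRHS]mul1r ler_wpM2r// mulr_ge0// ltW.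
have e3 : edot e (w (y r) - w (y s)) <= K * (2 * vbar * D).
  rewrite (le_trans (edot_le _ _))// -[leRHS]mul1r ler_pM ?enorm_ge0//.
  have rs01 : 0 <= r <= 1 /\ 0 <= s <= 1 by lra.
  rewrite (le_trans (wK _ _))//; try tauto.
  rewrite ler_wpM2l// (le_trans (clock_speed s0 (ltW sr) _))//; first by lra.
  rewrite ler_pM2l ?mulr_gt0// lerB// tau_le//; try lra.
move: e2 e3; rewrite !edotDr !edotNr edotZr /a /A => e2 e3.
have := ler_wpM2l f0 e3; lra.
Qed.

(** The clock may stand still on intervals, so [tt] is merely a right inverse of [tau / tau 1] from
    the intermediate value theorem, possibly discontinuous. This is harmless because [y] rests
    whenever the clock does ([tau_eq]). *)
Lemma reparametrization : tau 0 = 0 ->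
  exists x, [/\ admissible (2 * vbar * K * (tau 1) ^+ 2) (tau 1) x,
                x 0 = y 0 & x 1 = y 1].
Proof.
move=> tau0.
have tau_le a b : 0 <= a -> a <= b -> b <= 1 -> tau a <= tau b.
  move=> a0 ab b1; have := clock_speed a0 ab b1.
  move/(le_trans (enorm_ge0 _)); rewrite pmulr_rge0 ?subr_ge0//.
  by rewrite mulr_gt0.
have tau_eq a b : 0 <= a <= 1 -> 0 <= b <= 1 -> tau a = tau b -> y a = y b.
  wlog ab : a b / a <= b => [hw|].
    move=> a1 b1 E; have [ab|/ltW ba] := leP a b; first exact: hw.
    by apply/esym; apply: hw.
  move=> /andP[a0 _] /andP[_ b1] E; have := clock_speed a0 ab b1.
  rewrite E subrr mulr0 => h.
  apply/eqP; rewrite eq_sym -subr_eq0; apply/eqP; apply: enorm_eq0.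
  by apply/eqP; rewrite eq_le h enorm_ge0.
have T0 : 0 <= tau 1 by rewrite -tau0 tau_le.
have [tt htt] : exists tt : R -> R, forall u, 0 <= u <= 1 ->
    0 <= tt u <= 1 /\ tau (tt u) = u * tau 1.
  suff : forall u, exists v, 0 <= u <= 1 -> 0 <= v <= 1 /\ tau v = u * tau 1.
    by move=> /choice[tt htt]; exists tt.
  move=> u; have [u01|] := boolP (0 <= u <= 1); last by exists 0.
  have cont : {within `[0, 1], continuous (tau \o clamp)}.
    apply: continuous_subspaceT; exact: lipschitz_fun_continuous tau_lip.
  have [|c c01 hc] := @IVT R (tau \o clamp) 0 1 (u * tau 1) ler01 cont.
    rewrite /= !clamp_id ?lexx ?ler01// tau0 min_l// max_r//.
    by case/andP: u01 => u0 u1; rewrite mulr_ge0//= ler_piMl.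
  by exists c; move: c01 hc; rewrite in_itv/= => c01; rewrite clamp_id.
have key a b : 0 <= a <= 1 -> 0 <= b <= 1 -> tau a <= tau b ->
    enorm (y b - y a) <= 2 * vbar * (tau b - tau a) /\
    enorm (y b - y a - (tau b - tau a) *: w (y a)) <=
    vbar * (tau b - tau a) + 2 * vbar * K * (tau b - tau a) ^+ 2.
  move=> a01 b01 tab; have [ab|/ltW ba] := leP a b.
    case/andP: a01 => a0 a1; case/andP: b01 => b0 b1.
    by split; [exact: clock_speed|exact: clock_inclusion].
  (* In reversed order the clock readings agree, hence so do the points, and both bounds become 0 <=
     0. *)
  have E : tau a = tau b.
    apply/eqP; rewrite eq_le tab/=; case/andP: a01 => a0 a1; case/andP: b01 => b0 b1.
    exact: tau_le.
  by rewrite E (tau_eq a b a01 b01 E) !subrr scale0r subr0 enorm0 expr0n/= !mulr0 addr0.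
exists (y \o tt); split.
- move=> s t s0 st t1.
  have [h1 h2] : (0 <= tt s <= 1 /\ tau (tt s) = s * tau 1).
    by apply: htt; rewrite s0 (le_trans st).
  have [h3 h4] : (0 <= tt t <= 1 /\ tau (tt t) = t * tau 1).
    by apply: htt; rewrite t1 (le_trans s0).
  have := key _ _ h1 h3; rewrite h2 h4 => /(_ (ler_wpM2r T0 st)) [k1 k2].
  have E : t * tau 1 - s * tau 1 = tau 1 * (t - s) by ring.
  rewrite E in k1 k2; split; first by rewrite -mulrA.
  apply: le_trans k2 _.
  suff -> : vbar * (tau 1 * (t - s)) + 2 * vbar * K * (tau 1 * (t - s)) ^+ 2 =
    vbar * tau 1 * (t - s) + 2 * vbar * K * tau 1 ^+ 2 * (t - s) ^+ 2 by [].
  by ring.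
- have [h1 h2] : (0 <= tt 0 <= 1 /\ tau (tt 0) = 0 * tau 1) by apply: htt; rewrite lexx ler01.
  by apply: tau_eq; rewrite ?lexx ?ler01// h2 mul0r tau0.
- have [h1 h2] : (0 <= tt 1 <= 1 /\ tau (tt 1) = 1 * tau 1) by apply: htt; rewrite lexx ler01.
  by apply: tau_eq; rewrite ?lexx ?ler01// h2 mul1r.
Qed.

End Reparametrization.

(** Time can be wasted because the wind is weaker than the airspeed: the additional drift is at most
    [vbar] times the additional time. *)
Lemma admissibleW C C' T T' x : C <= C' -> 0 <= T -> T <= T' ->
  admissible C T x -> admissible C' T' x.
Proof.
move=> CC T0 TT hx s t s0 st t1; have [h1 h2] := hx s t s0 st t1.
have ts0 : 0 <= t - s by rewrite subr_ge0.
split.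
  apply: le_trans h1 _; rewrite ler_wpM2r// ler_wpM2l//.
  by rewrite mulr_ge0// ltW.
have -> : x t - x s - (T' * (t - s)) *: w (x s) =
    (x t - x s - (T * (t - s)) *: w (x s)) + - (((T' - T) * (t - s)) *: w (x s)).
  by rewrite -[RHS]addrA -opprD -scalerDl; congr (_ - _ *: _); ring.
rewrite (le_trans (enormD _ _))// enormN enormZ ger0_norm; last first.
  by rewrite mulr_ge0// subr_ge0.
have h3 : C * (t - s) ^+ 2 <= C' * (t - s) ^+ 2 by rewrite ler_wpM2r// sqr_ge0.
have h4 : (T' - T) * (t - s) * enorm (w (x s)) <= (T' - T) * (t - s) * vbar.
  by rewrite ler_wpM2l ?mulr_ge0 ?subr_ge0// ltW.
by lra.
Qed.

End Existence.

(** * Compactness of the admissible paths *)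

Section Compactness.
Context {R : realType}.
Variables (vbar W : R) (w : plane R -> plane R).
Hypothesis vbar_gt0 : 0 < vbar.
Hypothesis w_le : forall p, enorm (w p) <= W.
Hypothesis W_lt : W < vbar.
Hypothesis w_cont : continuous w.

Lemma enorm_continuous : continuous (enorm : plane R -> R).
Proof.
move=> u; apply: (@continuous_comp _ _ _ (fun v : plane R => edot v v) Num.sqrt);
  last exact: sqrt_continuous.
have c i : (fun v : plane R => v ord0 i) @ u --> u ord0 i by exact: coord_continuous.
have -> : (fun v : plane R => edot v v) =
  (fun v => v ord0 ord0 * v ord0 ord0 + v ord0 ord_max * v ord0 ord_max).
  by apply/funext => v; rewrite edotE.
exact: cvgD (cvgM (c _) (c _)) (cvgM (c _) (c _)).
Qed.

Lemma fmap_ultra (T1 T2 : Type) (f : T1 -> T2) (F : set_system T1) :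
  UltraFilter F -> UltraFilter (f @ F).
Proof.
move=> FU; split=> [|G GF sFG]; first exact: fmap_proper_filter.
rewrite predeqE => A; split=> [GA|]; last exact: sFG.
have [//|FnA] := in_ultra_setVsetC (f @^-1` A) FU.
have GnA : G (~` A) by exact: sFG.
by have [z []] := filter_ex (filterI GA GnA).
Qed.

(** All values stay in a fixed square around [p], so along a single ultrafilter the paths converge
    at all times simultaneously. For each pair of times, [admissible] is a closed condition on two
    values of the path, so it survives the pointwise limit. *)
Lemma admissible_limit (C T : R) (p q : plane R) : 0 <= T ->
  (forall n : nat, exists x, [/\ admissible vbar w C (T + n.+1%:R^-1) x, x 0 = p & x 1 = q]) ->
  exists x, [/\ admissible vbar w C T x, x 0 = p & x 1 = q].
Proof.
move=> T0 /choice[X hX].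
have [U [UU FU]] := ultraFilterLemma (@eventually_filter).
pose M := 2 * vbar * (T + 1).
have lim_ex (t : R) : exists z : plane R, 0 <= t <= 1 -> X n t @[n --> U] --> z.
  have [t01|] := boolP (0 <= t <= 1); last by exists 0.
  have : compact [set v : plane R | forall i,
      (`[p ord0 i - M, p ord0 i + M]%classic : set R) (v ord0 i)].
    apply: (@rV_compact _ _ (fun i => `[p ord0 i - M, p ord0 i + M]%classic : set R)) => i.
    exact: segment_compact.
  rewrite compact_ultra => cA.
  have UX : UltraFilter ((fun n => X n t) @ U).
    by exact: (@fmap_ultra _ _ (fun n => X n t) U UU).
  have [|z [_ hz]] := cA _ UX; last by exists z.
  suff hM n i : (`[p ord0 i - M, p ord0 i + M]%classic : set R) (X n t ord0 i).
    by apply: (@filterE _ U) => n; exact: hM.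
  rewrite /= in_itv/= -ler_distl.
  have [hadm h0 _] := hX n; case/andP: t01 => t0 t1.
  have [h1 _] := hadm _ _ (lexx 0) t0 t1; move: h1; rewrite h0 subr0 => h1.
  have := coord_le_enorm (X n t - p) i; rewrite !mxE => /le_trans; apply.
  apply: le_trans h1 _; rewrite /M -mulrA ler_wpM2l ?mulr_ge0 ?(ltW vbar_gt0)//.
  have : n.+1%:R^-1 <= 1 :> R by rewrite invf_le1// ler1n.
  have : 0 < n.+1%:R^-1 :> R by rewrite invr_gt0.
  by move: (n.+1%:R^-1) => e; nra.
have [x hx] := choice lim_ex.
have Tn : T + n.+1%:R^-1 @[n --> U] --> T.
  rewrite -[X in _ --> X]addr0; apply: cvgD; first exact: cvg_cst.
  apply: (cvg_trans (cvg_app _ FU)).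
  exact: cvg_harmonic.
exists x; split.
- move=> s t s0 st t1.
  have xs : X n s @[n --> U] --> x s by apply: hx; rewrite s0 (le_trans st).
  have xt : X n t @[n --> U] --> x t by apply: hx; rewrite t1 (le_trans s0).
  split.
    apply: (ler_cvg_to (a := U) (f := fun n => enorm (X n t - X n s))
        (g := fun n => 2 * vbar * (T + n.+1%:R^-1) * (t - s))).
    + exact: (cvg_comp _ _ (cvgB xt xs) (@enorm_continuous _)).
    + by apply: cvgM; [apply: cvgM => //; exact: cvg_cst|exact: cvg_cst].
    + apply: filterE => n; have [hadm _ _] := hX n.
      by have [] := hadm _ _ s0 st t1.
  apply: (ler_cvg_to (a := U)
     (f := fun n => enorm (X n t - X n s - ((T + n.+1%:R^-1) * (t - s)) *: w (X n s)))
     (g := fun n => vbar * (T + n.+1%:R^-1) * (t - s) + C * (t - s) ^+ 2)).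
  + have cw : w (X n s) @[n --> U] --> w (x s) := cvg_comp _ _ xs (@w_cont _).
    have cT : (T + n.+1%:R^-1) * (t - s) @[n --> U] --> T * (t - s).
      by apply: cvgM => //; exact: cvg_cst.
    exact: (cvg_comp _ _ (cvgB (cvgB xt xs) (cvgZ cT cw)) (@enorm_continuous _)).
  + apply: cvgD; last exact: cvg_cst.
    by apply: cvgM; [apply: cvgM => //; exact: cvg_cst|exact: cvg_cst].
  + apply: filterE => n; have [hadm _ _] := hX n.
    by have [] := hadm _ _ s0 st t1.
- have xs : X n 0 @[n --> U] --> x 0 by apply: hx; rewrite lexx ler01.
  apply: (cvg_unique _ xs); first exact: norm_hausdorff.
  by apply: cvg_near_cst; apply: filterE => n; have [] := hX n.
- have xs : X n 1 @[n --> U] --> x 1 by apply: hx; rewrite lexx ler01.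
  apply: (cvg_unique _ xs); first exact: norm_hausdorff.
  by apply: cvg_near_cst; apply: filterE => n; have [] := hX n.
Qed.

Let w_lt p : enorm (w p) < vbar.
Proof. exact: le_lt_trans W_lt. Qed.

Lemma minimal_admissible (C T0 : R) (p q : plane R) x0 : 0 <= T0 ->
  admissible vbar w C T0 x0 -> x0 0 = p -> x0 1 = q ->
  exists T x, [/\ 0 <= T, admissible vbar w C T x, x 0 = p, x 1 = q &
    forall T' x', 0 <= T' -> admissible vbar w C T' x' -> x' 0 = p ->
      x' 1 = q -> T <= T'].
Proof.
move=> T00 hx0 x00 x01.
pose S : set R := [set T | 0 <= T /\
  exists x, [/\ admissible vbar w C T x, x 0 = p & x 1 = q]].
have S0 : S T0 by split => //; exists x0.
have lbS : lbound S 0 by move=> T [].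
have hS : has_inf S by split; [exists T0|exists 0].
have inf0 : 0 <= inf S by apply: lb_le_inf => //; exists T0.
(* A duration within 1/(n+1) of the infimum is enlarged by [admissibleW] to exactly [inf S] plus
   1/(n+1). *)
have [n|x [h1 h2 h3]] := @admissible_limit C (inf S) p q inf0.
  have e0 : 0 < n.+1%:R^-1 :> R by rewrite invr_gt0.
  have [T [T0' [x [h1 h2 h3]]] hT] := inf_adherent e0 hS.
  by exists x; split => //; apply: (admissibleW vbar_gt0 w_le W_lt) h1 => //; exact: ltW.
exists (inf S), x; split => // T' x' T'0 h4 h5 h6.
by apply: ge_inf; [exists 0|split => //; exists x'].
Qed.

Lemma admissible_lipschitz (C T : R) x : admissible vbar w C T x ->
  lipschitz_path (2 * vbar * T) x.
Proof.
move=> hx a b /unit_itvP/andP[a0 a1] /unit_itvP/andP[b0 b1].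
have [ab|/ltW ba] := leP a b.
  by rewrite enormB distrC ger0_norm ?subr_ge0//; have [] := hx _ _ a0 ab b1.
by rewrite ger0_norm ?subr_ge0//; have [] := hx _ _ b0 ba a1.
Qed.

(** A converse of [reparametrization]: differentiation removes the quadratic error, so that |x' - T
    w(x)| <= vbar T almost everywhere, and [density_le] bounds the rate of the clock by [T]. *)
Lemma admissible_duration (C T : R) x : 0 <= T -> admissible vbar w C T x ->
  flight_duration vbar w x <= T.
Proof.
move=> T0 hx; have xlip := admissible_lipschitz hx.
have [K [tau [tau_lip tau0 tau1 hd]]] := clock vbar_gt0 w_le W_lt w_cont xlip.
have id_lip : lipschitz_fun 1 (@idfun R) by move=> s t _ _; rewrite mul1r.
have := @lipschitz_nonincreasing R _ _ 0 1 (lipschitz_fun_lin T tau_lip id_lip).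
rewrite tau1 tau0 /= mulr1 mulr0 subr0 subr_le0; apply; rewrite ?lexx ?ler01//.
apply: ae_imp hd => t ht t01; have [h1 h2] := ht t01.
have h3 : is_derive t 1 (@idfun R) (1 : R) by exact: is_derive_id.
exists (travel_density vbar w (x t) (path_deriv x t) - T * 1).
  exact: is_derive_lin h2 h3.
rewrite mulr1 subr_le0; apply: density_le => //.
case/andP: t01 => t0 t1.
apply: enorm_dual; first by rewrite mulr_ge0// ltW.
move=> e e1; rewrite edotDr edotNr edotZr mulrC.
have h4 := is_derive_lin (edot e (w (x t)) * T) (is_derive_edot e h1) h3.
rewrite mulr1 in h4; apply: (is_derive_le_right (C := C) (del := 1 - t) h4).
  by rewrite subr_gt0.
move=> s ts s1; have {}s1 : s <= 1 by lra.
have [_ h5] := hx _ _ (ltW t0) (ltW ts) s1.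
apply: le_trans h5.
apply: le_trans (le_trans (edot_le e _) _); last first.
  by rewrite -[leRHS]mul1r; apply: ler_wpM2r e1; exact: enorm_ge0.
by rewrite !edotDr !edotNr edotZr /=; lra.
Qed.

Hypothesis w_lip : forall rho : R, exists2 K : R, 0 <= K &
  forall p q, enorm p <= rho -> enorm q <= rho ->
    enorm (w p - w q) <= K * enorm (p - q).

(** The error constant [C] has to serve all competitors at once. Those no slower than [y0] stay
    within distance 2 vbar T0 of [p], where one Lipschitz constant of [w] is valid; the slower ones
    are beaten by [y0]. *)
Lemma global_minimizer (p q : plane R) y0 : trajectories p q setT y0 ->
  exists C T x, [/\ 0 <= C, 0 <= T, admissible vbar w C T x,
    is_minimizer (flight_duration vbar w) (trajectories p q setT) x &
    forall y, trajectories p q setT y -> T <= flight_duration vbar w y].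
Proof.
move=> hy0; have [T0 T0E] : exists T0, T0 = flight_duration vbar w y0.
  by exists (flight_duration vbar w y0).
have dur_ge0 y : 0 <= flight_duration vbar w y.
  by apply: Rintegral_ge0 => t _; exact: density_ge0.
have [K K0 hK] := w_lip (enorm p + 2 * vbar * T0).
pose C := 2 * vbar * K * T0 ^+ 2.
have adm y : trajectories p q setT y -> flight_duration vbar w y <= T0 ->
    exists x, [/\ admissible vbar w C (flight_duration vbar w y) x, x 0 = p & x 1 = q].
  move=> [_ [k yk] yp yq] yT0.
  have [Kt [tau [tau_lip tau0 tau1 hd]]] := clock vbar_gt0 w_le W_lt w_cont yk.
  have tau_le a b : 0 <= a -> a <= b -> b <= 1 -> tau a <= tau b.
    move=> a0 ab b1; have := clock_speed vbar_gt0 w_le W_lt yk tau_lip hd a0 ab b1.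
    move/(le_trans (enorm_ge0 _)); rewrite pmulr_rge0 ?subr_ge0//.
    by rewrite mulr_gt0.
  have ball r : 0 <= r <= 1 -> enorm (y r) <= enorm p + 2 * vbar * T0.
    move=> /andP[r0 r1]; rewrite -[y r](subrK p) addrC (le_trans (enormD _ _))//.
    rewrite lerD2l -yp (le_trans (clock_speed vbar_gt0 w_le W_lt yk tau_lip hd _ r0 r1))//.
    rewrite tau0 subr0 ler_wpM2l ?mulr_ge0 ?(ltW vbar_gt0)//.
    rewrite -tau1 in yT0; exact: le_trans (tau_le _ _ r0 r1 (lexx 1)) yT0.
  have [|x [hx x0 x1]] := reparametrization vbar_gt0 w_le W_lt yk tau_lip hd K0 _ tau0.
    by move=> r s r01 s01; apply: hK; exact: ball.
  exists x; split; [|by rewrite x0|by rewrite x1].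
  rewrite -tau1.
  have tau1_ge0 : 0 <= tau 1 by rewrite tau1.
  have tau1_le : tau 1 <= T0 by rewrite tau1.
  apply: (admissibleW vbar_gt0 w_le W_lt _ tau1_ge0 (lexx _) hx).
  apply: ler_wpM2l; first by apply: mulr_ge0 => //; apply: mulr_ge0 => //; exact: ltW.
  by rewrite ler_sqr ?nnegrE//; apply: le_trans tau1_le.
have y0T : flight_duration vbar w y0 <= T0 by rewrite T0E.
have [x0 [hx0 x00 x01]] := adm _ hy0 y0T.
have [T [x [hT hx xp xq xmin]]] := minimal_admissible (dur_ge0 y0) hx0 x00 x01.
have Tmin y : trajectories p q setT y -> T <= flight_duration vbar w y.
  move=> hy; have [yT|/ltW yT] := leP (flight_duration vbar w y) T0.
    by have [z [hz zp zq]] := adm _ hy yT; exact: (xmin _ _ (dur_ge0 y) hz).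
  by apply: le_trans yT; rewrite T0E; exact: (xmin _ _ (dur_ge0 y0) hx0).
exists C, T, x; split; [|exact: hT|exact: hx| |exact: Tmin].
- apply: mulr_ge0; last exact: sqr_ge0.
  by apply: mulr_ge0 => //; apply: mulr_ge0 => //; exact: ltW.
- split.
    by split => //; exists (2 * vbar * T); exact: admissible_lipschitz hx.
  by move=> y hy; apply: le_trans (Tmin _ hy); exact: admissible_duration hx.
Qed.

End Compactness.

(** * Inscribed polygons *)

Section Gluing.
Context {R : realType}.

(** A pair of times on both sides of [b] is split there. The distance is abstract so as to cover
    both points of the plane and clock readings. *)
Lemma glue_lipschitz (V : Type) (dist : V -> V -> R) (k a b c : R) (f : R -> V) :
  (forall x y, dist x y = dist y x) ->
  (forall x y z, dist x z <= dist x y + dist y z) ->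
  (forall s t, a <= s <= b -> a <= t <= b -> dist (f s) (f t) <= k * `|s - t|) ->
  (forall s t, b <= s <= c -> b <= t <= c -> dist (f s) (f t) <= k * `|s - t|) ->
  forall s t, a <= s <= c -> a <= t <= c -> dist (f s) (f t) <= k * `|s - t|.
Proof.
move=> sym tri h1 h2 s t; wlog st : s t / s <= t => [hw|].
  move=> hs ht; have [st|/ltW ts] := leP s t; first exact: hw.
  by rewrite sym distrC; exact: hw.
move=> /andP[as_ sc] /andP[at_ tc].
have [tb|/ltW bt] := leP t b.
  by apply: h1; rewrite ?as_ ?at_ ?(le_trans st).
have [sb|/ltW bs] := leP s b; last by apply: h2; rewrite ?bs ?bt.
apply: le_trans (tri _ (f b) _) _.
apply: le_trans (lerD (h1 s b _ _) (h2 b t _ _)) _;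
    rewrite ?as_ ?sb ?bt ?lexx ?(le_trans as_)//.
  by rewrite (le_trans bt).
rewrite -mulrDr ler0_norm ?subr_le0// ler0_norm ?subr_le0// ler0_norm ?subr_le0//.
by suff -> : - (s - b) + - (b - t) = - (s - t) by []; ring.
Qed.

Lemma is_derive_affine (t c m t0 : R) :
  is_derive t 1 (fun s : R => c + (s - t0) * m) m.
Proof.
have -> : (fun s : R => c + (s - t0) * m) = cst (c - t0 * m) + m \*: id.
  by apply/funext => s; rewrite -[RHS]/(c - t0 * m + m * s); ring.
rewrite -[X in is_derive _ _ _ X]add0r -[X in is_derive _ _ _ (_ + X)]mulr1.
by apply: is_deriveD.
Qed.

Lemma is_derive_affine_path (t t0 : R) (a u : plane R) :
  is_derive t 1 (fun s : R => a + (s - t0) *: u) u.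
Proof.
apply/is_derive_coordP => i.
have -> : (fun s : R => (a + (s - t0) *: u) ord0 i) =
    (fun s : R => a ord0 i + (s - t0) * u ord0 i).
  by apply/funext => s; rewrite !mxE.
exact: is_derive_affine.
Qed.

Lemma is_derive_dilate (t c d : R) (f : R -> R) : is_derive (c * t) 1 f d ->
  is_derive t 1 (fun s => f (c * s)) (c * d).
Proof.
move=> fd; have hc : is_derive t 1 (fun s : R => c * s) (c : R).
  have := is_derive_affine t 0 c 0.
  by under eq_fun do rewrite add0r subr0 mulrC.
have := is_derive1_comp fd hc; rewrite mulrC; exact.
Qed.

Lemma is_derive_dilate_path (t c : R) (d : plane R) (f : R -> plane R) :
  is_derive (c * t) 1 f d -> is_derive t 1 (fun s => f (c * s)) (c *: d).
Proof.
move=> /is_derive_coordP fd; apply/is_derive_coordP => i.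
by rewrite mxE; exact: (is_derive_dilate (fd i)).
Qed.

Lemma ae_notin (F : seq R) : {ae @lebesgue_measure R, forall t : R, t \notin F}.
Proof.
exists [set` F]; split.
- apply: countable_measurable; [exact: measurable_set1|exact/finite_set_countable/finite_seq].
- exact/countable_lebesgue_measure0/finite_set_countable/finite_seq.
- by move=> t /= /negP; rewrite negbK.
Qed.

End Gluing.

Section Polygons.
Context {R : realType}.
Variables (vbar W : R) (w : plane R -> plane R).
Hypothesis vbar_gt0 : 0 < vbar.
Hypothesis w_le : forall p, enorm (w p) <= W.
Hypothesis W_lt : W < vbar.
Hypothesis w_cont : continuous w.

Let w_lt p : enorm (w p) < vbar.
Proof. exact: le_lt_trans W_lt. Qed.

Lemma density_scale_le (p q : plane R) (a : R) : 0 <= a ->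
  travel_density vbar w p (a *: q) <= a * travel_density vbar w p q.
Proof.
move=> a0; set f := travel_density _ _ _ q.
have f0 : 0 <= f by exact: density_ge0.
apply: density_le => //; first exact: mulr_ge0.
by rewrite -scalerA -scalerBr enormZ ger0_norm// density_eq// -/f; lra.
Qed.

Variable Omega : set (plane R).

(* A polygonal path of unit speed on [0, len] together with a clock [g] that
   never runs slower than the flight; [F] contains the break points. *)
Record arc (len : R) (y : R -> plane R) (g : R -> R) : Prop := Arc {
  arc_len : 0 <= len;
  arc_in : forall t, 0 <= t <= len -> Omega (y t);
  arc_lip : forall s t, 0 <= s <= len -> 0 <= t <= len ->
    enorm (y s - y t) <= 1 * `|s - t|;
  arc_clock_lip : exists M, forall s t, 0 <= s <= len -> 0 <= t <= len ->
    `|g s - g t| <= M * `|s - t|;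
  arc_der : exists F : seq R, forall t, 0 < t < len -> t \notin F ->
    exists d e, [/\ is_derive t 1 y d, is_derive t 1 g e, enorm d = 1 &
      travel_density vbar w (y t) d <= e] }.

Lemma arc_const p : Omega p -> arc 0 (cst p) (cst 0).
Proof.
move=> Op; split => //.
- by move=> s t _ _; rewrite subrr enorm0 mul1r.
- by exists 0 => s t _ _; rewrite subrr normr0 mul0r.
- by exists [::] => t /andP[t0 /(lt_trans t0)]; rewrite ltxx.
Qed.

(** On the new segment, of length [l], the clock runs at the constant rate [c / l]: by
    [density_scale_le], the cost [c] of the whole segment becomes this cost per unit of length. *)
Lemma arc_append len y g b c : arc len y g ->
  (forall s, 0 <= s <= 1 -> Omega (y len + s *: (b - y len))) ->
  (forall s, 0 <= s <= 1 ->
    travel_density vbar w (y len + s *: (b - y len)) (b - y len) <= c) ->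
  exists len' y' g', [/\ arc len' y' g', y' 0 = y 0, y' len' = b &
    g' len' - g' 0 <= g len - g 0 + c].
Proof.
move=> [len0 yO ylip [M glip] [F yder]] segO segc.
have c0 : 0 <= c.
  by have := segc 0; rewrite lexx ler01 => /(_ isT); apply: le_trans; exact: density_ge0.
(* A segment of length zero has no direction; the arc is then kept as it is, and [c0] covers the
   claim on the clock. *)
have [ba|/eqP ba] := eqVneq (b - y len) 0.
  exists len, y, g; split => //; first by split => //; [exists M|exists F].
    by apply/eqP; rewrite eq_sym -subr_eq0 ba.
  by rewrite lerDl.
set a := y len in segO segc ba *.
pose l := enorm (b - a).
have l0 : 0 < l.
  rewrite lt_def enorm_ge0 andbT; apply/eqP => /enorm_eq0; exact: ba.
pose u := l^-1 *: (b - a).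
have u1 : enorm u = 1 by rewrite enormZ ger0_norm ?invr_ge0 ?ltW// mulVf// gt_eqF.
pose y' t := if t <= len then y t else a + (t - len) *: u.
pose g' t := if t <= len then g t else g len + (t - len) * (c / l).
have y'2 t : len <= t -> y' t = a + (t - len) *: u.
  rewrite /y' le_eqVlt => /orP[/eqP<-|h]; last by rewrite leNgt h.
  by rewrite lexx subrr scale0r addr0.
have g'2 t : len <= t -> g' t = g len + (t - len) * (c / l).
  rewrite /g' le_eqVlt => /orP[/eqP<-|h]; last by rewrite leNgt h.
  by rewrite lexx subrr mul0r addr0.
have y'1 t : t <= len -> y' t = y t by rewrite /y' => ->.
have g'1 t : t <= len -> g' t = g t by rewrite /g' => ->.
have seg t : len <= t -> t <= len + l -> 0 <= (t - len) / l <= 1 /\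
    y' t = a + ((t - len) / l) *: (b - a).
  move=> t1 t2; rewrite y'2// scalerA; split => //.
  by rewrite divr_ge0 ?subr_ge0 ?(ltW l0)//= ler_pdivrMr// mul1r lerBlDl.
exists (len + l), y', g'; split.
- split.
  + by rewrite addr_ge0// ltW.
  + move=> t /andP[t0 tl]; have [tlen|/ltW tlen] := leP t len.
      by rewrite y'1//; apply: yO; rewrite t0.
    by have [h ->] := seg t tlen tl; exact: segO.
  + apply: (@glue_lipschitz _ _ (fun u v => enorm (u - v)) 1 0 len).
    * by move=> *; exact: enormB.
    * by move=> *; exact: enorm_tri.
    * by move=> s t hs ht; rewrite !y'1; [exact: ylip|case/andP: ht|case/andP: hs].
    * move=> s t /andP[hs _] /andP[ht _]; rewrite !y'2//.
      by rewrite opprD addrACA subrr add0r -scalerBl enormZ u1 mulr1 mul1r opprB addrA subrK.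
  + exists (Num.max M (c / l)).
    apply: (@glue_lipschitz _ _ (fun u v => `|u - v|) _ 0 len).
    * by move=> *; exact: distrC.
    * by move=> *; exact: ler_distD.
    * move=> s t hs ht; rewrite !g'1; [|by case/andP: ht|by case/andP: hs].
      by apply: le_trans (glip _ _ hs ht) _; rewrite ler_wpM2r// le_max lexx.
    * move=> s t /andP[hs _] /andP[ht _]; rewrite !g'2//.
      rewrite opprD addrACA subrr add0r -mulrBl opprB addrA subrK normrM mulrC.
      rewrite ler_wpM2r// ger0_norm ?divr_ge0 ?(ltW l0)//.
      by rewrite le_max lexx orbT.
  + exists (len :: F) => t /andP[t0 tl]; rewrite inE negb_or => /andP[tlen tF].
    have [tl1|tl1] := ltP t len.
      have [|d [e [h1 h2 h3 h4]]] := yder t _ tF; first by rewrite t0.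
      exists d, e; split => //.
      * apply: near_eq_is_derive h1; apply: filterS (lt_nbhsl tl1) => s sl.
        by rewrite y'1// ltW.
      * apply: near_eq_is_derive h2; apply: filterS (lt_nbhsl tl1) => s sl.
        by rewrite g'1// ltW.
      * by rewrite y'1// ltW.
    have {}tl1 : len < t by rewrite lt_neqAle eq_sym tlen.
    exists u, (c / l); split => //.
    * apply: near_eq_is_derive (is_derive_affine_path t len a u).
      by apply: filterS (lt_nbhsr tl1) => s sl; rewrite y'2// ltW.
    * apply: near_eq_is_derive (is_derive_affine t (g len) (c / l) len).
      by apply: filterS (lt_nbhsr tl1) => s sl; rewrite g'2// ltW.
    * have [h ->] := seg t (ltW tl1) (ltW tl).
      rewrite (le_trans (density_scale_le _ _ _)) ?invr_ge0 ?(ltW l0)//.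
      by rewrite mulrC ler_wpM2r ?invr_ge0 ?(ltW l0)// segc.
- by rewrite y'1.
- rewrite y'2 ?lerDl ?(ltW l0)//.
  by rewrite [len + l]addrC addrK /u scalerA divff ?gt_eqF// scale1r addrC subrK.
- rewrite g'2 ?lerDl ?(ltW l0)// g'1// [len + l]addrC addrK mulrCA divff ?gt_eqF// mulr1.
  by rewrite addrAC.
Qed.

End Polygons.

Section Inscribed.
Context {R : realType}.
Let mu := @lebesgue_measure R.
Variables (vbar W : R) (w : plane R -> plane R).
Hypothesis vbar_gt0 : 0 < vbar.
Hypothesis w_le : forall p, enorm (w p) <= W.
Hypothesis W_lt : W < vbar.
Hypothesis w_cont : continuous w.
Variable Omega : set (plane R).

Let w_lt p : enorm (w p) < vbar.
Proof. exact: le_lt_trans W_lt. Qed.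

Lemma arc_chain (n : nat) (x : nat -> plane R) (c : R) : Omega (x 0%N) ->
  (forall i (s : R), (i < n)%N -> 0 <= s <= 1 -> Omega (x i + s *: (x i.+1 - x i))) ->
  (forall i (s : R), (i < n)%N -> 0 <= s <= 1 ->
    travel_density vbar w (x i + s *: (x i.+1 - x i)) (x i.+1 - x i) <= c) ->
  exists len y g, [/\ arc vbar w Omega len y g, y 0 = x 0%N, y len = x n &
    g len - g 0 <= n%:R * c].
Proof.
elim: n => [|n IHn] x0 hO hc.
  exists 0, (cst (x 0%N)), (cst 0); split => //; first exact: arc_const.
  by rewrite subrr mul0r.
have [i s ni|i s ni|len [y [g [hy y0 yl hg]]]] := IHn x0.
- by apply: hO; exact: ltnW.
- by apply: hc; exact: ltnW.
have [||len' [y' [g' [h1 h2 h3 h4]]]] :=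
  @arc_append _ _ _ _ vbar_gt0 w_le W_lt _ _ _ _ (x n.+1) c hy.
- by move=> s hs; rewrite yl; apply: hO.
- by move=> s hs; rewrite yl; apply: hc.
exists len', y', g'; split => //; first by rewrite h2.
by rewrite -natr1 mulrDl mul1r; apply: le_trans h4 _; rewrite lerD2r.
Qed.

Lemma arc_trajectory len y g : arc vbar w Omega len y g -> 0 < len ->
  exists2 Y, constant_speed_trajectories (y 0) (y len) Omega Y &
    flight_duration vbar w Y <= g len - g 0.
Proof.
move=> [_ yO ylip [M glip] [F yder]] len0.
pose Y t := y (len * t).
have sc t : 0 <= t <= 1 -> 0 <= len * t <= len.
  by move=> /andP[t0 t1]; rewrite mulr_ge0 ?(ltW len0)//= ler_piMr// ltW.
have Ylip : lipschitz_path len Y.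
  move=> s t /unit_itvP/sc hs /unit_itvP/sc ht; rewrite (le_trans (ylip _ _ hs ht))//.
  by rewrite mul1r -mulrBr normrM gtr0_norm.
have hd : {ae mu, forall t : R, 0 < t < 1 -> exists d e, [/\ is_derive t 1 Y (len *: d),
    is_derive t 1 (fun t => g (len * t)) (len * e), enorm d = 1 &
    travel_density vbar w (Y t) d <= e]}.
  apply: ae_imp (ae_notin [seq s / len | s <- F]) => t tF /andP[t0 t1].
  have [||d [e [h1 h2 h3 h4]]] := yder (len * t).
  - by rewrite mulr_gt0//= gtr_pMr.
  - apply: contra tF => h; apply/mapP; exists (len * t) => //.
    by rewrite mulrAC divff ?mul1r// gt_eqF.
  by exists d, e; split => //; [exact: is_derive_dilate_path|exact: is_derive_dilate].
exists Y.
  split.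
    split.
    - by move=> t /unit_itvP/sc; exact: yO.
    - by exists len.
    - by rewrite /Y mulr0.
    - by rewrite /Y mulr1.
  exists len.
  apply: ae_imp (ae_and hd (ae_and (ae_neq 0) (ae_neq 1))) => t [h [tn0 tn1]].
  move=> /unit_itvP/andP[t0 t1].
  have t01 : 0 < t < 1 by rewrite !lt_neqAle t0 t1 tn1 eq_sym tn0.
  have [d [e [h1 h2 h3 h4]]] := h t01.
  by rewrite (path_deriv_is_derive t01 h1) enormZ h3 mulr1 gtr0_norm.
have [K [tau [tau_lip tau0 tau1 htau]]] := clock vbar_gt0 w_le W_lt w_cont Ylip.
have Glip : lipschitz_fun (M * len) (fun t => g (len * t)).
  move=> s t /unit_itvP/sc hs /unit_itvP/sc ht; rewrite (le_trans (glip _ _ hs ht))//.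
  by rewrite -mulrBr normrM (gtr0_norm len0) mulrA.
have := @lipschitz_nonincreasing R _ _ 0 1 (lipschitz_fun_lin 1 tau_lip Glip).
rewrite tau1 tau0 !mul1r mulr1 mulr0 sub0r => h.
suff : flight_duration vbar w Y - g len <= - g 0 by lra.
apply: h; rewrite ?lexx ?ler01//.
apply: ae_imp (ae_and hd htau) => t [h1 h2] t01.
have [d [e [h3 h4 h5 h6]]] := h1 t01; have [h7 h8] := h2 t01.
exists (travel_density vbar w (Y t) (path_deriv Y t) - 1 * (len * e)).
  exact: is_derive_lin h8 h4.
rewrite (path_deriv_is_derive t01 h3) mul1r subr_le0.
apply: le_trans (density_scale_le vbar_gt0 w_le W_lt _ _ (ltW len0)) _.
by rewrite ler_pM2l.
Qed.

(** Each of the [n.+1] chords costs at most [T / N + eta]. The summand [eta] pays for the error C /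
    N^2 of [admissible] and for the variation of the wind along a chord, at most K times 2 vbar T /
    N, acting for the time T / N. Extra time gains a margin of at least vbar - W per unit, whence
    the denominator in [eta]. *)
Lemma inscribed_polygon (C T K : R) (p q : plane R) x (n : nat) :
  0 <= C -> 0 <= T -> 0 <= K -> p <> q ->
  (forall a b s, Omega a -> Omega b -> 0 <= s <= 1 -> Omega (a + s *: (b - a))) ->
  (forall a b, Omega a -> Omega b -> enorm (w a - w b) <= K * enorm (a - b)) ->
  admissible vbar w C T x -> x 0 = p -> x 1 = q ->
  (forall t, 0 <= t <= 1 -> Omega (x t)) ->
  exists2 Y, constant_speed_trajectories p q Omega Y &
    flight_duration vbar w Y <= T + (C + 2 * vbar * K * T ^+ 2) / (vbar - W) / n.+1%:R.
Proof.
move=> C0 T0 K0 pq conv wK hx xp xq xO.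
pose N : R := n.+1%:R; have N0 : 0 < N by rewrite ltr0n.
pose X (i : nat) := x (i%:R / N).
have iN i : (i <= n.+1)%N -> 0 <= i%:R / N <= 1.
  by move=> h; rewrite divr_ge0 ?(ltW N0)//= ler_pdivrMr// mul1r ler_nat.
have XO i : (i <= n.+1)%N -> Omega (X i) by move=> h; apply: xO; exact: iN.
pose E := C + 2 * vbar * K * T ^+ 2.
have E0 : 0 <= E.
  by rewrite addr_ge0// mulr_ge0 ?sqr_ge0// mulr_ge0// mulr_ge0// ltW.
have vW : 0 < vbar - W by rewrite subr_gt0.
pose eta := E / (vbar - W) / N ^+ 2.
have eta0 : 0 <= eta by rewrite !divr_ge0 ?sqr_ge0// ltW.
have etaE : eta * (vbar - W) = E / N ^+ 2.
  by rewrite /eta; field; rewrite !gt_eqF.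
pose c := T / N + eta.
have c0 : 0 <= c by rewrite addr_ge0// divr_ge0// ltW.
have [||i s ni s01|len [y [g [hy y0 yl hg]]]] := @arc_chain n.+1 X c.
- exact: XO.
- move=> i s ni s01; apply: conv => //; apply: XO => //; exact: ltnW.
- set a := X i; set b := X i.+1; set p' := a + s *: (b - a).
  have aO : Omega a by apply: XO; exact: ltnW.
  have bO : Omega b by exact: XO.
  have p'O : Omega p' by exact: conv.
  have stp : i.+1%:R / N - i%:R / N = N^-1 by rewrite -mulrBl -natr1 addrC addKr mul1r.
  have le1 : i%:R / N <= i.+1%:R / N by rewrite ler_pM2r ?invr_gt0// ler_nat.
  have /andP[i0 _] := iN i (ltnW ni); have /andP[_ i1] := iN i.+1 ni.
  have := hx _ _ i0 le1 i1; rewrite stp -/(X i) -/(X i.+1) -/a -/b => -[h1 h2].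
  have h3 : enorm (w p' - w a) <= K * (2 * vbar * T / N).
    apply: le_trans (wK _ _ p'O aO) _; rewrite ler_wpM2l//.
    rewrite /p' addrC addKr enormZ; apply: le_trans h1.
    by case/andP: s01 => s0 s1; rewrite ger0_norm// ler_piMl// enorm_ge0.
  apply: density_le => //.
  have -> : b - a - c *: w p' = (b - a - (T / N) *: w a)
      + ((T / N) *: (w a - w p') + - (eta *: w p')).
    rewrite scalerBr /c scalerDl opprD.
    by rewrite [in RHS]addrA [in RHS]addrA subrK addrA.
  apply: le_trans (enormD _ _) _; apply: le_trans (lerD h2 (enormD _ _)) _.
  rewrite enormN !enormZ (enormB (w a)).
  have TN : 0 <= T / N by rewrite divr_ge0// ltW.
  rewrite (ger0_norm eta0) (ger0_norm TN).
  have h4 := ler_wpM2l TN h3; have h5 := ler_wpM2l eta0 (w_le p').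
  have h6 : T / N * (K * (2 * vbar * T / N)) + C * N^-1 ^+ 2 = E / N ^+ 2.
    by rewrite /E; field; rewrite gt_eqF.
  have h7 : vbar * c = vbar * T / N + eta * W + eta * (vbar - W).
    by rewrite /c; field; rewrite gt_eqF.
  rewrite h7 etaE -h6; move: h4 h5.
  move: (T / N * enorm _) (T / N * (K * _)) (eta * enorm _) (eta * W) (vbar * T / N) (C * _).
  by move=> *; lra.
have yp : y 0 = p by rewrite y0 /X mul0r.
have yq : y len = q by rewrite yl /X divff ?gt_eqF.
have len0 : 0 < len.
  rewrite lt_def (arc_len hy) andbT; apply/eqP => l0; apply: pq.
  by rewrite -yp -yq l0.
have [Y hY hT] := arc_trajectory hy len0; exists Y; first by rewrite -yp -yq.
apply: le_trans hT _; apply: le_trans hg _.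
suff -> : n.+1%:R * c = T + E / (vbar - W) / N by [].
by rewrite /c /eta -/N; field; rewrite !gt_eqF.
Qed.

End Inscribed.

(** * Second differences of the travel density *)

Section Regularity.
Context {R : realType}.
Implicit Types (F : plane R -> plane R) (p q u v e : plane R).

Definition e0 : plane R := mkplane 1 0.
Definition e1 : plane R := mkplane 0 1.

Lemma plane_basis u : u = u ord0 ord0 *: e0 + u ord0 ord_max *: e1.
Proof. by apply/rowP; apply: ord2P; rewrite !mxE/= ?mulr1 ?mulr0 ?addr0 ?add0r. Qed.

Lemma derive_basis F p u : differentiable F p ->
  'D_u F p = u ord0 ord0 *: 'D_e0 F p + u ord0 ord_max *: 'D_e1 F p.
Proof. by move=> dF; rewrite !deriveE// {1}[u]plane_basis linearD !linearZ. Qed.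

Lemma is_derive_line F q u (t : R) : differentiable F (q + t *: u) ->
  is_derive t 1 (fun t : R => F (q + t *: u)) ('D_u F (q + t *: u)).
Proof.
move=> dF; have [h1 h2] := derivableP (diff_derivable dF : derivable F _ u).
have E : (fun h : R => h^-1 *: (((fun t : R => F (q + t *: u)) \o shift t) (h *: 1) -
     F (q + t *: u))) =
   (fun h => h^-1 *: ((F \o shift (q + t *: u)) (h *: u) - F (q + t *: u))).
  apply/funext => h /=; congr (_ *: (F _ - _)).
  by rewrite [h *: 1]mulr1 scalerDl addrCA.
by apply: DeriveDef; rewrite /derivable /derive/= E.
Qed.

Lemma edot_line_le (f : R -> plane R) (f' : R -> plane R) (c : R) : 0 <= c ->
  (forall t : R, is_derive t 1 f (f' t)) ->
  (forall t, 0 <= t <= 1 -> enorm (f' t) <= c) -> enorm (f 1 - f 0) <= c.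
Proof.
move=> c0 hf hc; apply: enorm_dual => // e he.
have hd (t : R) : is_derive t 1 (fun s => edot e (f s)) (edot e (f' t)).
  exact: is_derive_edot.
have [|x] := MVT (f := fun s => edot e (f s)) (df := fun s => edot e (f' s)) ltr01
  (fun x _ => hd x).
  apply: continuous_subspaceT => x; apply: differentiable_continuous.
  by apply/derivable1_diffP; have [] := hd x.
rewrite in_itv/= => /andP[x0 x1] E.
rewrite edotDr edotNr E subr0 mulr1 (le_trans (edot_le _ _))//.
rewrite -[leRHS]mul1r ler_pM ?enorm_ge0 ?hc//.
by rewrite !ltW.
Qed.

Definition square (rho : R) : set (plane R) :=
  [set v | forall i, (`[- rho, rho]%classic : set R) (v ord0 i)].

Lemma ball_square (rho : R) p : enorm p <= rho -> square rho p.
Proof.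
move=> h i; rewrite /= in_itv/= -ler_norml.
exact: le_trans (coord_le_enorm p i) h.
Qed.

Lemma continuous_bounded_square (rho : R) F : 0 <= rho -> continuous F ->
  exists2 B : R, 0 <= B & forall p, enorm p <= rho -> enorm (F p) <= B.
Proof.
move=> rho0 cF.
have cA : compact (square rho).
  apply: (@rV_compact _ _ (fun i : 'I_2 => `[- rho, rho]%classic : set R)) => i.
  exact: segment_compact.
have A0 : square rho !=set0.
  by exists 0; apply: ball_square; rewrite enorm0.
have [|c _ hc] := @EVT_max_rV _ _ (fun p => enorm (F p)) (square rho) A0 cA.
  apply: continuous_subspaceT => p.
  exact: (continuous_comp (cF p) (@enorm_continuous _ _)).
exists (enorm (F c)); first exact: enorm_ge0.
by move=> p hp; apply: hc; rewrite inE; exact: ball_square.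
Qed.

Lemma enorm_convex p q (t : R) rho : 0 <= t <= 1 -> enorm p <= rho -> enorm q <= rho ->
  enorm (q + t *: (p - q)) <= rho.
Proof.
move=> /andP[t0 t1] hp hq.
have -> : q + t *: (p - q) = t *: p + (1 - t) *: q.
  by rewrite scalerBr scalerBl scale1r addrCA.
apply: le_trans (enormD _ _) _; rewrite !enormZ !ger0_norm ?subr_ge0//.
by have := enorm_ge0 p; nra.
Qed.

(** The mean value inequality on segments. Continuity of ['D_u F] is given for each fixed [u], so
    the bound is assembled from the two basis directions. *)
Lemma locally_lipschitz F : (forall p, differentiable F p) ->
  (forall u, continuous ('D_u F)) ->
  forall rho : R, exists2 K : R, 0 <= K &
  forall p q, enorm p <= rho -> enorm q <= rho ->
    enorm (F p - F q) <= K * enorm (p - q).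
Proof.
move=> dF cF rho; have [rho0|rho0] := leP 0 rho; last first.
  exists 0 => // p q; have := enorm_ge0 p; lra.
have [B0 B00 hB0] := continuous_bounded_square rho0 (cF e0).
have [B1 B10 hB1] := continuous_bounded_square rho0 (cF e1).
exists (B0 + B1); first exact: addr_ge0.
move=> p q hp hq.
have := @edot_line_le (fun t : R => F (q + t *: (p - q)))
  (fun t : R => 'D_(p - q) F (q + t *: (p - q))) ((B0 + B1) * enorm (p - q)).
rewrite /= scale1r scale0r addr0 [q + _]addrC subrK; apply.
- by rewrite mulr_ge0 ?addr_ge0 ?enorm_ge0.
- by move=> t; exact: is_derive_line.
- move=> t t01; have hr := enorm_convex t01 hp hq.
  rewrite (derive_basis _ (dF _)); move: (hB0 _ hr) (hB1 _ hr).
  move: ('D_e0 F (q + t *: (p - q))) ('D_e1 F (q + t *: (p - q))) => z0 z1 h0 h1.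
  rewrite (le_trans (enormD _ _))// 2!enormZ mulrDl.
  by apply: lerD; rewrite mulrC ler_pM ?enorm_ge0 ?normr_ge0// coord_le_enorm.
Qed.

Variable w : plane R -> plane R.
Hypothesis w_C2 : twice_continuously_differentiable w.

Lemma C2_continuous : continuous w.
Proof. by case: w_C2 => h _ _ p; exact: differentiable_continuous. Qed.

Lemma C2_lipschitz (rho : R) : exists2 K : R, 0 <= K &
  forall p q, enorm p <= rho -> enorm q <= rho ->
    enorm (w p - w q) <= K * enorm (p - q).
Proof.
case: w_C2 => h1 h2 _; apply: locally_lipschitz => // u p.
exact: differentiable_continuous.
Qed.

(** The derivative of w(p + t d) + w(p - t d) in [t] is a difference of derivatives of [w] in
    direction [d] at points at most 2 |d| apart. As the partial derivatives are locally Lipschitz,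
    it is quadratic in |d|. *)
Lemma C2_second_difference (rho : R) : exists2 K : R, 0 <= K &
  forall p d, enorm p + enorm d <= rho ->
    enorm (w (p + d) + w (p - d) - 2 *: w p) <= K * enorm d ^+ 2.
Proof.
case: w_C2 => h1 h2 h3.
have [K0 K00 hK0] := locally_lipschitz (h2 e0) (h3 e0) rho.
have [K1 K10 hK1] := locally_lipschitz (h2 e1) (h3 e1) rho.
exists (2 * (K0 + K1)); first by rewrite mulr_ge0// addr_ge0.
move=> p d hpd; pose N := enorm d; have N0 : 0 <= N by exact: enorm_ge0.
have := @edot_line_le (fun t : R => w (p + t *: d) + w (p + t *: - d))
  (fun t : R => 'D_d w (p + t *: d) + 'D_(- d) w (p + t *: - d)) (2 * (K0 + K1) * N ^+ 2).
rewrite /= !scale1r !scale0r addr0 -mulr2n scaler_nat; apply.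
- by rewrite !mulr_ge0 ?addr_ge0.
- by move=> t; apply: is_deriveD; exact: is_derive_line.
- move=> t /andP[t0 t1].
  have b1 : enorm (p + t *: d) <= rho.
    rewrite (le_trans (enormD _ _))// enormZ ger0_norm// (le_trans _ hpd)// lerD2l.
    by rewrite -/N ler_piMl.
  have b2 : enorm (p + t *: - d) <= rho.
    rewrite (le_trans (enormD _ _))// enormZ enormN ger0_norm// (le_trans _ hpd)// lerD2l.
    by rewrite -/N ler_piMl.
  have b3 : enorm (p + t *: d - (p + t *: - d)) <= 2 * N.
    have -> : p + t *: d - (p + t *: - d) = (2 * t) *: d.
      by rewrite scalerN opprB addrC addrA subrK -scalerDl; congr (_ *: _); ring.
    by rewrite enormZ ger0_norm ?mulr_ge0// -/N -mulrA ler_pM2l// ler_piMl.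
  rewrite (derive_basis d (h1 _)) (derive_basis (- d) (h1 _)) !mxE.
  have -> : d ord0 ord0 *: 'D_e0 w (p + t *: d) + d ord0 ord_max *: 'D_e1 w (p + t *: d) +
     (- d ord0 ord0 *: 'D_e0 w (p + t *: - d) + - d ord0 ord_max *: 'D_e1 w (p + t *: - d)) =
     d ord0 ord0 *: ('D_e0 w (p + t *: d) - 'D_e0 w (p + t *: - d)) +
     d ord0 ord_max *: ('D_e1 w (p + t *: d) - 'D_e1 w (p + t *: - d)).
    by rewrite addrACA !scalerBr !scaleNr.
  have k0 := le_trans (hK0 _ _ b1 b2) (ler_wpM2l K00 b3).
  have k1 := le_trans (hK1 _ _ b1 b2) (ler_wpM2l K10 b3).
  move: ('D_e0 w (p + t *: d) - 'D_e0 w (p + t *: - d)) k0 => z0 k0.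
  move: ('D_e1 w (p + t *: d) - 'D_e1 w (p + t *: - d)) k1 => z1 k1.
  have -> : 2 * (K0 + K1) * N ^+ 2 = N * (K0 * (2 * N)) + N * (K1 * (2 * N)) by ring.
  apply: le_trans (enormD _ _) _; rewrite 2!enormZ.
  apply: lerD; apply: ler_pM; rewrite ?enorm_ge0 ?normr_ge0//; exact: coord_le_enorm.
Qed.

End Regularity.

Section SecondDifference.
Context {R : realType}.
Variables (v : R) (w : plane R -> plane R).
Hypothesis v_gt0 : 0 < v.
Hypothesis w_lt : forall p, enorm (w p) < v.
Implicit Types p q d om ep : plane R.

(* The candidate [t0 + a + b] dominates the travel density at the perturbed
   arguments: [a] is its first-order variation and [b] absorbs the second-order
   terms. *)
Lemma density_perturb_le p q p1 d om ep (a b m rho : R)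
    (t0 := travel_density v w p q) (A := q - t0 *: w p)
    (B := d - a *: w p - t0 *: om) :
  w p1 = w p + om + ep ->
  edot A B = v ^+ 2 * t0 * a -> edot A (w p) = v * t0 * (m - v) ->
  0 <= b -> 0 <= t0 + a + b -> rho <= v * (t0 + a + b) ->
  enorm (a *: om + b *: om + (t0 + a + b) *: ep) <= rho ->
  (enorm B + b * enorm (w p)) ^+ 2 <= 2 * v * t0 * (b * m - rho) ->
  travel_density v w p1 (q + d) <= t0 + a + b.
Proof.
move=> w1 AB Aw b0 t1 hrho hr hB; apply: density_le => //; rewrite w1.
set r := a *: om + _ + _ in hr.
have -> : q + d - (t0 + a + b) *: (w p + om + ep) = (A + (B - b *: w p)) + - r.
  by apply/rowP => i; rewrite /A /B /r !mxE; ring.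
apply: le_trans (enormD _ _) _; rewrite enormN.
(* Both sides are squared, with |A| = v t0. The terms linear in [a] cancel by [AB], and the rest is
   [h1] plus the square [h2]. *)
suff h : enorm (A + (B - b *: w p)) <= v * (t0 + a + b) - rho by lra.
rewrite enorm_leP ?subr_ge0//.
rewrite -enorm_sqr enorm_sqrD density_eq// edotDr edotNr edotZr AB Aw.
have h1 : enorm (B - b *: w p) ^+ 2 <= 2 * v * t0 * (b * m - rho).
  apply: le_trans hB;
    rewrite ler_sqr ?nnegrE ?enorm_ge0 ?addr_ge0 ?enorm_ge0 ?mulr_ge0 ?enorm_ge0//.
  by rewrite (le_trans (enormBD _ _))// enormZ (ger0_norm b0).
have h2 : 0 <= (v * a + v * b - rho) ^+ 2 by exact: sqr_ge0.
rewrite -/t0; nra.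
Qed.

(** Reversing the signs of [d], [om] and [a] while keeping [ep] and [b] preserves the hypotheses of
    [density_perturb_le]. In the sum of the candidates t0 + a + b and t0 - a + b the first variation
    cancels. *)
Lemma density_second_difference_le p q p1 p2 d om ep (a b m rho : R)
    (t0 := travel_density v w p q) (A := q - t0 *: w p)
    (B := d - a *: w p - t0 *: om) :
  w p1 = w p + om + ep -> w p2 = w p - om + ep ->
  edot A B = v ^+ 2 * t0 * a -> edot A (w p) = v * t0 * (m - v) ->
  0 <= b -> `|a| + b <= t0 -> 0 <= rho -> rho <= v * (t0 - `|a|) ->
  (`|a| + b) * enorm om + 2 * t0 * enorm ep <= rho ->
  (enorm B + b * enorm (w p)) ^+ 2 <= 2 * v * t0 * (b * m - rho) ->
  travel_density v w p1 (q + d) + travel_density v w p2 (q - d) - 2 * t0 <= 2 * b.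
Proof.
move=> w1 w2 AB Aw b0 abt rho0 hrho hr hB.
have [na1 na2] : - `|a| <= a /\ a <= `|a| by apply/andP; rewrite -ler_norml.
have rb (a' : R) (om' : plane R) : `|a'| = `|a| -> enorm om' = enorm om ->
    enorm (a' *: om' + b *: om' + (t0 + a' + b) *: ep) <= rho.
  move=> ha ho; apply: le_trans hr; rewrite -scalerDl.
  apply: le_trans (enormD _ _) _; rewrite !enormZ ho; apply: lerD.
    rewrite ler_wpM2r ?enorm_ge0//; apply: le_trans (ler_normD _ _) _.
    by rewrite ha (ger0_norm b0).
  rewrite ler_wpM2r ?enorm_ge0//.
  have := ler_norm a'; have := ler_norm (- a'); rewrite normrN ha => h1 h2.
  by rewrite ger0_norm; lra.
have va : v * (t0 - `|a|) <= v * (t0 + a + b) /\ v * (t0 - `|a|) <= v * (t0 - a + b).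
  by split; rewrite ler_pM2l//; lra.
have f1 : travel_density v w p1 (q + d) <= t0 + a + b.
  apply: (density_perturb_le w1 AB Aw b0 _ _ (rb a om erefl erefl) hB); rewrite -/t0; lra.
have f2 : travel_density v w p2 (q - d) <= t0 - a + b.
  have EB : - d - - a *: w p - t0 *: - om = - B.
    by apply/rowP => i; rewrite /B !mxE; ring.
  apply: (@density_perturb_le p q p2 (- d) (- om) ep (- a) b m rho) => //.
  - by rewrite EB edotNr AB -/t0; ring.
  - by rewrite -/t0; lra.
  - by rewrite -/t0; lra.
  - by apply: rb; [rewrite normrN|rewrite enormN].
  - by rewrite EB enormN.
lra.
Qed.

End SecondDifference.

Lemma small_linear (R : realFieldType) (K c : R) : 0 < c ->
  exists2 e : R, 0 < e & forall x, 0 < x <= e -> K * x <= c.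
Proof.
move=> c0; have K1 : 0 < `|K| + 1 by rewrite ltr_wpDl.
exists (c / (`|K| + 1)); first by rewrite divr_gt0.
move=> x /andP[x0]; rewrite ler_pdivlMr// => h.
have := ler_norm K; have := normr_ge0 K; nra.
Qed.

Section SecondDifferenceSmall.
Context {R : realType}.
Variables (v : R) (w : plane R -> plane R).
Hypothesis v_gt0 : 0 < v.
Hypothesis w_lt : forall p, enorm (w p) < v.

(* In the use below, [tau] is [t0 m / |q|] and [3 g] is the factor with which
   the first-order deviation enters; 184/3 = 4/3 * 23 * 2 is the constant of the
   alpha2 term of the bound, and the summand 3 absorbs the higher orders. *)
Lemma second_difference_margin (g tau : R) : 1 <= g -> g <= 20 / 11 -> 1 <= tau * g ->
  9 * g ^+ 2 + 3 <= 184 / 3 * tau.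
Proof.
move=> g1 g2 tg; have g0 : 0 < g by lra.
rewrite -(ler_pM2r g0).
have h : 184 / 3 <= 184 / 3 * tau * g by lra.
apply: le_trans h.
have g3 : g ^+ 2 <= 400 / 121 by nra.
have -> : (9 * g ^+ 2 + 3) * g = 9 * (g ^+ 2 * g) + 3 * g by ring.
have : g ^+ 2 * g <= 400 / 121 * (20 / 11) by rewrite ler_pM ?sqr_ge0// ltW.
lra.
Qed.

(* 9/20 is a rational upper bound of [1 / sqrt 5]. *)
Lemma density_second_difference_small (L sigma k1 k2 : R) :
  0 < L -> 0 < sigma -> 0 <= k1 -> 0 <= k2 ->
  exists2 eta0 : R, 0 < eta0 & forall (eta : R) (p q p1 p2 d : plane R),
    0 < eta <= eta0 -> eta <= 1 -> enorm q = L -> enorm (w p) <= 9 / 20 * v ->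
    enorm (w p1 - w p2) <= 2 * k1 * eta ^+ 2 ->
    enorm (w p1 + w p2 - 2 *: w p) <= 2 * k2 * eta ^+ 3 ->
    enorm d <= sigma * (3 * eta + 2 * eta ^+ 2) ->
    travel_density v w p1 (q + d) + travel_density v w p2 (q - d)
      - 2 * travel_density v w p q <= 184 / 3 * sigma ^+ 2 / (L * v) * eta ^+ 2.
Proof.
move=> L0 s0 k10 k20.
(* Bounds for t0: the ground speed is at most 2 v, and at least 11/20 v for a wind of at most 9/20
   v. *)
pose tlo := L / (2 * v); pose thi := 20 / 11 * L / v.
have tlo0 : 0 < tlo by rewrite divr_gt0// mulr_gt0.
have c1 : 0 <= 20 / 11 :> R by lra.
have c2 : 0 <= 92 / 3 :> R by lra.
have thi0 : 0 < thi by rewrite divr_gt0// mulr_gt0//; lra.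
have thk : 0 <= thi * k1 by rewrite mulr_ge0// ltW.
have s1 := ltW s0; have v1 := ltW v_gt0.
have st5 : 0 <= 5 * sigma + thi * k1 by lra.
have st2 : 0 <= 2 * sigma + thi * k1 by lra.
(* [al], [be], [ro] measure |a|, b, rho in units of eta, eta^2, eta^3; [be] carries half of the
   claimed constant, as the second difference is at most 2 b. [M] collects the second-order part of
   |B| + b |w|, and [N] the orders from three on in its square. *)
pose al := 20 / 11 * (5 * sigma + thi * k1) / v.
have al0 : 0 <= al by rewrite divr_ge0// mulr_ge0.
pose be := 92 / 3 * sigma ^+ 2 / (L * v).
have be0 : 0 <= be by rewrite divr_ge0// ?mulr_ge0// ?sqr_ge0// ltW.
pose ro := (al + be) * k1 + 2 * thi * k2.
have ro0 : 0 <= ro by rewrite addr_ge0// mulr_ge0// ?addr_ge0// mulr_ge0// ltW.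
pose M := 20 / 11 * (2 * sigma + thi * k1) + be * v.
have M0 : 0 <= M by rewrite addr_ge0// mulr_ge0.
pose N := 12 * sigma * M + M ^+ 2.
have N0 : 0 <= N by rewrite addr_ge0 ?sqr_ge0// mulr_ge0// mulr_ge0.
(* The three thresholds secure |a| + b <= t0, then rho <= v (t0 - |a|), and finally that the higher
   orders fit into 3 sigma^2. *)
have [x1 x10 hx1] := small_linear (al + be) tlo0.
have [x2 x20 hx2] := small_linear (ro + v * al) (mulr_gt0 v_gt0 tlo0).
have [|x3 x30 hx3] := @small_linear _ (N + 2 * v * thi * ro) (3 * sigma ^+ 2).
  by rewrite mulr_gt0// exprn_gt0.
exists (Num.min x1 (Num.min x2 x3)); first by rewrite !lt_min x10 x20 x30.
move=> eta p q p1 p2 d /andP[e0]; rewrite !le_min => /and3P[e1 e2 e3] ele qL wp hom hep hd.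
have {e1}hx1 : (al + be) * eta <= tlo by apply: hx1; rewrite e0.
have {e2}hx2 : (ro + v * al) * eta <= v * tlo by apply: hx2; rewrite e0.
have {e3}hx3 : (N + 2 * v * thi * ro) * eta <= 3 * sigma ^+ 2 by apply: hx3; rewrite e0.
set t0 := travel_density v w p q.
have t0lo : tlo <= t0.
  rewrite ler_pdivrMr ?mulr_gt0// -qL mulrC; exact: enorm_le_density.
have t0hi : t0 <= thi.
  have W : 9 / 20 * v < v by move: v_gt0; lra.
  apply: le_trans (density_le_enorm v_gt0 w_lt _ wp W) _.
  have -> : thi = L / (v - 9 / 20 * v).
    by rewrite /thi; field; rewrite !gt_eqF//; move: v_gt0; lra.
  by rewrite qL.
have t00 : 0 < t0 by exact: lt_le_trans t0lo.
pose A := q - t0 *: w p.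
have hA : enorm A = v * t0 by exact: density_eq.
have vt0 : 0 < v * t0 by exact: mulr_gt0.
(* A / (v t0) is the unit heading of the aircraft, so [m] is the component of the ground velocity q
   / t0 along the heading. *)
pose m := v + edot A (w p) / (v * t0).
have Aw : edot A (w p) = v * t0 * (m - v).
  by rewrite /m addrC addKr mulrC divfK// gt_eqF.
have wn0 := enorm_ge0 (w p).
have [mlo mhi] : 11 / 20 * v <= m /\ m - v <= 9 / 20 * v.
  have h1 : `|edot A (w p)| <= v * t0 * (9 / 20 * v).
    by apply: le_trans (ler_edot_norm _ _) _; rewrite hA ler_pM2l.
  move: h1; rewrite Aw normrM gtr0_norm// ler_pM2l// ler_norml => /andP[h1 h2].
  by split; move: h1 h2; clear; lra.
have m0 : 0 < m by move: mlo v_gt0; clear; lra.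
(* Odd and even part of the variation of the wind under the reflection. *)
pose om := 2^-1 *: (w p1 - w p2).
pose ep := 2^-1 *: (w p1 + w p2 - 2 *: w p).
have omle : enorm om <= k1 * eta ^+ 2.
  by rewrite enormZ ger0_norm ?invr_ge0//; move: hom; clear; lra.
have eple : enorm ep <= k2 * eta ^+ 3.
  by rewrite enormZ ger0_norm ?invr_ge0//; move: hep; clear; lra.
(* The solution of the linear equation [AB], in which [B] itself contains [a]. *)
pose a := edot A (d - t0 *: om) / (v * t0 * m).
pose B := d - a *: w p - t0 *: om.
have AB : edot A B = v ^+ 2 * t0 * a.
  have h1 : edot A (d - t0 *: om) = v * t0 * m * a.
    by rewrite /a mulrC divfK// gt_eqF// mulr_gt0.
  have -> : B = (d - t0 *: om) - a *: w p by rewrite /B addrAC.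
  by rewrite edotDr edotNr edotZr h1 Aw; ring.
pose S := enorm d + t0 * enorm om.
have t01 := ltW t00.
have S0 : 0 <= S.
  by apply: addr_ge0; [exact: enorm_ge0|apply: mulr_ge0 => //; exact: enorm_ge0].
have ale : `|a| <= S / m.
  rewrite /a normrM normfV (gtr0_norm (mulr_gt0 vt0 m0)) (ler_pdivrMr _ _ (mulr_gt0 vt0 m0)).
  have -> : S / m * (v * t0 * m) = v * t0 * S by field; rewrite gt_eqF.
  apply: le_trans (ler_edot_norm _ _) _; rewrite hA ler_pM2l//.
  by apply: le_trans (enormBD _ _) _; rewrite enormZ (gtr0_norm t00).
have e20 : 0 <= eta ^+ 2 by exact: sqr_ge0.
have e2e : eta ^+ 2 <= eta by rewrite expr2 ler_piMl// ltW.
have e3E : eta ^+ 3 = eta ^+ 2 * eta by rewrite exprSr.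
have Sle : S <= 3 * sigma * eta + (2 * sigma + thi * k1) * eta ^+ 2.
  have h1 : t0 * enorm om <= thi * (k1 * eta ^+ 2).
    by rewrite ler_pM// enorm_ge0.
  by move: h1 hd; rewrite /S; clear; lra.
have Sle2 : S <= (5 * sigma + thi * k1) * eta.
  apply: le_trans Sle _.
  by have := ler_wpM2l st2 e2e; clear; lra.
have ale2 : `|a| <= al * eta.
  apply: le_trans ale _; rewrite ler_pdivrMr//; apply: le_trans Sle2 _.
  have -> : al * eta * m = (5 * sigma + thi * k1) * eta * (20 / 11 * m / v).
    by rewrite /al; field; rewrite gt_eqF.
  rewrite ler_peMr//.
    by rewrite mulr_ge0 ?(ltW e0).
  by rewrite ler_pdivlMr//; move: mlo; clear; lra.
pose b := be * eta ^+ 2.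
have b0 : 0 <= b by exact: mulr_ge0.
have b1 : b <= be * eta by rewrite /b ler_wpM2l.
have -> : 184 / 3 * sigma ^+ 2 / (L * v) * eta ^+ 2 = 2 * b.
  by rewrite /b /be; field; rewrite !gt_eqF.
pose g := 1 + enorm (w p) / m.
have g1 : 1 <= g by rewrite lerDl divr_ge0// ltW.
have g2 : g <= 20 / 11.
  have : enorm (w p) / m <= 9 / 11 by rewrite ler_pdivrMr//; move: mlo wp; clear; lra.
  by rewrite /g; clear; lra.
(* That is, |q| <= t0 (m + |w|): in |A + t0 w|^2 = t0^2 (v^2 + 2 v (m - v) + |w|^2) the first two
   summands add up to m^2 - (m - v)^2. *)
have Lg : L <= t0 * m * g.
  have -> : t0 * m * g = t0 * (m + enorm (w p)) by rewrite /g; field; rewrite gt_eqF.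
  rewrite -qL enorm_leP; last by rewrite mulr_ge0// addr_ge0// ltW.
  have -> : q = A + t0 *: w p by rewrite /A subrK.
  rewrite -enorm_sqr enorm_sqrD edotZr Aw enormZ (gtr0_norm t00) hA.
  have h1 : 0 <= (m - v) ^+ 2 + 2 * m * enorm (w p).
    by rewrite addr_ge0 ?sqr_ge0// mulr_ge0// mulr_ge0// ltW.
  have h2 : 0 <= t0 ^+ 2 by exact: sqr_ge0.
  by have := mulr_ge0 h2 h1; clear; lra.
have Xle : enorm B + b * enorm (w p) <= 3 * sigma * g * eta + M * eta ^+ 2.
  have h1 : enorm B <= S * g.
    have -> : S * g = S + S / m * enorm (w p) by rewrite /g; ring.
    have := ler_wpM2r wn0 ale.
    have := enormBD (d - a *: w p) (t0 *: om); have := enormBD d (a *: w p).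
    rewrite -/B (enormZ t0 om) (enormZ a (w p)) (gtr0_norm t00) => n1 n2 n3.
    have n4 : S = enorm d + t0 * enorm om by [].
    by move: n1 n2 n3; rewrite n4; clear; lra.
  have h2 : S * g <= 3 * sigma * eta * g + (20 / 11 * (2 * sigma + thi * k1)) * eta ^+ 2.
    have h3 := ler_wpM2r (le_trans ler01 g1) Sle.
    have h4 : (2 * sigma + thi * k1) * eta ^+ 2 * g <=
        (2 * sigma + thi * k1) * eta ^+ 2 * (20 / 11).
      by rewrite ler_wpM2l// mulr_ge0.
    by move: h3 h4; clear; lra.
  have h5 : b * enorm (w p) <= be * v * eta ^+ 2.
    have h6 : enorm (w p) <= v by move: wp v_gt0; clear; lra.
    by have := ler_wpM2l b0 h6; rewrite /b; clear; lra.
  by move: h1 h2 h5; rewrite /M; clear; lra.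
apply: (@density_second_difference_le _ _ _ v_gt0 w_lt
  p q p1 p2 d om ep a b m (ro * eta ^+ 3)) => //.
- by rewrite /om /ep; apply/rowP => i; rewrite !mxE; field.
- by rewrite /om /ep; apply/rowP => i; rewrite !mxE; field.
- by rewrite -/t0; move: hx1 ale2 b1 t0lo; clear; lra.
- by rewrite mulr_ge0// exprn_ge0// ltW.
- have h1 : ro * eta ^+ 3 <= ro * eta.
    rewrite ler_wpM2l// e3E; apply: le_trans (ler_wpM2r (ltW e0) e2e) _.
    by rewrite -expr2.
  have h2 := ler_wpM2l v1 ale2; have h3 := ler_wpM2l v1 t0lo.
  by rewrite -/t0; move: h1 h2 h3 hx2; clear; lra.
- have h1 : (`|a| + b) * enorm om <= (al + be) * eta * (k1 * eta ^+ 2).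
    apply: ler_pM; rewrite ?addr_ge0 ?enorm_ge0//.
    by move: ale2 b1; clear; lra.
  have h2 : 2 * t0 * enorm ep <= 2 * thi * (k2 * eta ^+ 3).
    by apply: ler_pM => //; [rewrite mulr_ge0|exact: enorm_ge0|rewrite ler_pM2l].
  by rewrite -/t0; apply: le_trans (lerD h1 h2) _; rewrite /ro e3E; clear; lra.
have X0 : 0 <= enorm B + b * enorm (w p).
  by apply: addr_ge0; [exact: enorm_ge0|exact: mulr_ge0].
have h1 : (enorm B + b * enorm (w p)) ^+ 2 <= (3 * sigma * g * eta + M * eta ^+ 2) ^+ 2.
  by rewrite ler_sqr ?nnegrE// (le_trans X0).
rewrite -/t0 -/A -/B; apply: le_trans h1 _.
have h2 : (3 * sigma * g * eta + M * eta ^+ 2) ^+ 2 <=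
    (9 * sigma ^+ 2 * g ^+ 2) * eta ^+ 2 + N * eta * eta ^+ 2.
  have -> : (3 * sigma * g * eta + M * eta ^+ 2) ^+ 2 =
    (9 * sigma ^+ 2 * g ^+ 2) * eta ^+ 2 +
    (6 * sigma * g * M + M ^+ 2 * eta) * eta * eta ^+ 2 by ring.
  rewrite lerD2l ler_wpM2r// ler_wpM2r ?(ltW e0)// /N.
  have h3 : 6 * sigma * g * M <= 12 * sigma * M.
    have h4 : sigma * M * g <= sigma * M * 2.
      by rewrite ler_wpM2l ?mulr_ge0//; move: g2; clear; lra.
    by move: h4; clear; lra.
  by rewrite lerD// ler_piMr// sqr_ge0.
apply: le_trans h2 _.
have tau1 : 1 <= t0 * m / L * g by rewrite mulrAC ler_pdivlMr// mul1r.
have marg := second_difference_margin g1 g2 tau1.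
have h5 : 2 * v * t0 * (b * m - ro * eta ^+ 3) =
    (184 / 3 * (t0 * m / L) * sigma ^+ 2 - 2 * v * t0 * ro * eta) * eta ^+ 2.
  by rewrite /b /be e3E; field; rewrite !gt_eqF.
rewrite h5 -mulrDl ler_wpM2r//.
have h6 := ler_wpM2r (sqr_ge0 sigma) marg.
have h7 : v * t0 * ro * eta <= v * thi * ro * eta.
  by rewrite ler_wpM2r ?(ltW e0)// ler_wpM2r// ler_wpM2l.
by move: hx3 h6 h7; clear; lra.
Qed.

End SecondDifferenceSmall.

(** * Discrete paths *)

Section Increment.
Context {R : realType}.
Let mu := @lebesgue_measure R.

(** With [c = 0] this bounds distances by the speed; with [c] the velocity at one instant it is the
    first-order Taylor estimate. *)
Lemma path_increment (k M a b : R) (y : R -> plane R) (c : plane R) :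
  lipschitz_path k y -> 0 <= a -> a <= b -> b <= 1 ->
  {ae mu, forall t : R, a < t < b -> exists2 d, is_derive t 1 y d & enorm (d - c) <= M} ->
  0 <= M -> enorm (y b - y a - (b - a) *: c) <= M * (b - a).
Proof.
move=> yk a0 ab b1 hd M0; apply: enorm_dual => [|e e1].
  by rewrite mulr_ge0// subr_ge0.
have id_lip : lipschitz_fun 1 (@idfun R) by move=> s t _ _; rewrite mul1r.
rewrite !edotDr !edotNr edotZr.
suff : edot e (y b) - (edot e c + M) * b <= edot e (y a) - (edot e c + M) * a by lra.
apply: (lipschitz_nonincreasing
  (lipschitz_fun_lin (edot e c + M) (lipschitz_path_edot e yk) id_lip)) => //.
apply: ae_imp hd => t ht tab; have [d h1 h2] := ht tab.
have h3 : is_derive t 1 (@idfun R) (1 : R) by exact: is_derive_id.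
exists (edot e d - (edot e c + M) * 1).
  exact: is_derive_lin (is_derive_edot e h1) h3.
have : edot e (d - c) <= M.
  apply: le_trans (edot_le _ _) _; rewrite -[leRHS]mul1r.
  by apply: ler_pM; rewrite ?enorm_ge0.
by rewrite edotDr edotNr mulr1; lra.
Qed.

End Increment.

Section Interpolation.
Context {R : realType}.
Variables (n : nat) (x : nat -> plane R).
Hypothesis n_gt0 : (0 < n)%N.
Let N : R := n%:R.

Let N_gt0 : 0 < N. Proof. by rewrite ltr0n. Qed.

Lemma interpolant_node (i : nat) : interpolant n x (i%:R / N) = x i.
Proof.
rewrite /interpolant -/N mulrC divfK ?gt_eqF//.
by rewrite natrK subrr scale0r addr0.
Qed.

(** At a node floor and ceiling coincide and the interpolant reduces to the vertex, so both ends of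
    the piece are treated separately. *)
Lemma interpolantE (i : nat) (t : R) : i%:R / N <= t -> t <= i.+1%:R / N ->
  interpolant n x t = x i + (t - i%:R / N) *: (N *: (x i.+1 - x i)).
Proof.
move=> ti; rewrite le_eqVlt => /orP[/eqP->|ti1].
  have -> : i.+1%:R / N - i%:R / N = N^-1.
    by rewrite -mulrBl -natr1 [_ + 1]addrC addrK mul1r.
  rewrite interpolant_node scalerA mulVf ?gt_eqF//.
  by rewrite scale1r addrC subrK.
move: ti; rewrite le_eqVlt => /orP[/eqP<-|ti].
  by rewrite interpolant_node subrr scale0r addr0.
have h1 : i%:R < N * t by rewrite mulrC -ltr_pdivrMr.
have h2 : N * t < i.+1%:R by rewrite mulrC -ltr_pdivlMr.
have lo : Num.truncn (N * t) = i.
  by apply: truncn_def; rewrite (ltW h1).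
have hi : `|Num.ceil (N * t)|%N = i.+1.
  rewrite (@ceil_def _ _ i.+1%:Z)//.
  by rewrite intrB -!pmulrn mulr1n -natr1 addrK h1 natr1 ltW.
rewrite /interpolant -/N lo hi scalerA; congr (_ + _ *: _).
by rewrite mulrBl divfK ?gt_eqF// mulrC.
Qed.

Lemma interpolant_is_derive (i : nat) (t : R) : i%:R / N < t -> t < i.+1%:R / N ->
  is_derive t 1 (interpolant n x) (N *: (x i.+1 - x i)).
Proof.
move=> ti ti1; apply: near_eq_is_derive (is_derive_affine_path t (i%:R / N) (x i) _).
near=> s; rewrite (interpolantE (i := i))//; apply: ltW; near: s.
- exact: lt_nbhsr.
- exact: lt_nbhsl.
Unshelve. all: by end_near. Qed.

Lemma interpolant_lipschitz (M : R) :
  (forall i, (i < n)%N -> enorm (x i.+1 - x i) <= M) ->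
  lipschitz_path (N * M) (interpolant n x).
Proof.
move=> hM.
have h j : (j <= n)%N -> forall s t : R, 0 <= s <= j%:R / N -> 0 <= t <= j%:R / N ->
    enorm (interpolant n x s - interpolant n x t) <= (N * M) * `|s - t|.
  elim: j => [_|j IHj jn].
    rewrite mul0r => s t /andP[s0 s1] /andP[t0 t1].
    have -> : s = 0 by apply/eqP; rewrite eq_le s0 s1.
    have -> : t = 0 by apply/eqP; rewrite eq_le t0 t1.
    by rewrite !subrr enorm0 normr0 mulr0.
  apply: (@glue_lipschitz R _ (fun u v => enorm (u - v)) _ 0 (j%:R / N)).
  - by move=> *; exact: enormB.
  - by move=> *; exact: enorm_tri.
  - exact: (IHj (ltnW jn)).
  - move=> s t /andP[s0 s1] /andP[t0 t1]; rewrite !(interpolantE (i := j))//.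
    rewrite opprD addrACA subrr add0r -scalerBl opprB addrA subrK scalerA enormZ.
    rewrite normrM (gtr0_norm N_gt0).
    have -> : N * M * `|s - t| = `|s - t| * N * M by ring.
    by rewrite ler_wpM2l ?hM// mulr_ge0// ltW.
have {}h := h n (leqnn n).
move=> s t /unit_itvP hs /unit_itvP ht; apply: h; rewrite divff ?gt_eqF//.
Qed.

Lemma grid_piece (t : R) : 0 < t < 1 -> t \notin [seq i%:R / N | i <- iota 0 n.+1] ->
  exists i, [/\ (i < n)%N, i%:R / N < t & t < i.+1%:R / N].
Proof.
move=> /andP[t0 t1] tn; pose i := Num.truncn (N * t).
have Nt : 0 <= N * t by rewrite mulr_ge0// ltW.
have /andP[h1 h2] := truncn_itv Nt; rewrite -/i in h1 h2.
have i_n : (i < n)%N.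
  rewrite -(ltr_nat R); apply: le_lt_trans h1 _.
  by rewrite gtr_pMr.
exists i; split => //; last by rewrite ltr_pdivlMr// mulrC.
rewrite lt_neqAle; apply/andP; split; last by rewrite ler_pdivrMr// mulrC.
apply: contra tn => /eqP <-; apply/mapP; exists i => //.
by rewrite mem_iota /= add0n ltnS; exact: ltnW.
Qed.

End Interpolation.

(** * Geometry of the ellipse *)

Section Ellipse.
Context {R : realType}.
Variables (p q : plane R) (Omega : set (plane R)).
Hypothesis Omega_ellipse : filled_ellipse p q Omega.

Lemma ellipse_convex a b (s : R) : Omega a -> Omega b -> 0 <= s <= 1 ->
  Omega (a + s *: (b - a)).
Proof.
case: Omega_ellipse => r _ -> /= ha hb /andP[s0 s1].
have h c : enorm (a + s *: (b - a) - c) <= (1 - s) * enorm (a - c) + s * enorm (b - c).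
  have -> : a + s *: (b - a) - c = (1 - s) *: (a - c) + s *: (b - c).
    by apply/rowP => i; rewrite !mxE; ring.
  apply: le_trans (enormD _ _) _.
  by rewrite (enormZ (1 - s)) (enormZ s) !ger0_norm ?subr_ge0.
apply: le_trans (lerD (h p) (h q)) _.
have s1' : 0 <= 1 - s by rewrite subr_ge0.
have := ler_wpM2l s1' ha; have := ler_wpM2l s0 hb; lra.
Qed.

Lemma ellipse_bounded : exists rho : R, forall x, Omega x -> enorm x <= rho.
Proof.
case: Omega_ellipse => r _ ->; exists (r + enorm p) => x /= hx.
rewrite -[x in enorm x](subrK p); apply: le_trans (enormD _ _) _.
by rewrite lerD2r; apply: le_trans hx; rewrite lerDl enorm_ge0.
Qed.

(** The points p + (q - p) / (n + 1) of the focal segment are distinct and belong to the ellipse. *)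
Lemma ellipse_infinite : p <> q -> ~ finite_set Omega.
Proof.
move=> pq fO; pose f (n : nat) := p + n.+1%:R^-1 *: (q - p).
have fOm n : Omega (f n).
  have e0 : 0 <= n.+1%:R^-1 :> R by rewrite invr_ge0.
  have e1 : n.+1%:R^-1 <= 1 :> R by rewrite invf_le1// ler1n.
  case: Omega_ellipse => r hr ->; rewrite /f /=; move: (n.+1%:R^-1) e0 e1 => t t0 t1.
  have -> : p + t *: (q - p) - p = t *: (q - p) by rewrite addrC addKr.
  have -> : p + t *: (q - p) - q = (t - 1) *: (q - p).
    by apply/rowP => i; rewrite !mxE; ring.
  rewrite !enormZ ger0_norm// ler0_norm ?subr_le0//.
  by move: hr; lra.
have finj : injective f.
  move=> m n /addrI /eqP; rewrite -subr_eq0 -scalerBl scaler_eq0 => /orP[|].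
    by rewrite subr_eq0 => /eqP /invr_inj /eqP; rewrite eqr_nat => /eqP [].
  by rewrite subr_eq0 => /eqP qp; case: pq.
have : finite_set (f @^-1` Omega) by apply: finite_preimage => // m n _ _; exact: finj.
have -> : f @^-1` Omega = setT by apply/seteqP; split => // n _; exact: fOm.
exact: infinite_nat.
Qed.

End Ellipse.

(** * Bounds for the coefficients and for the wind speed *)

Section Coefficients.
Context {R : realType}.

(** Boundedness is not assumed: a set without supremum has [sup] equal to 0 by convention. *)
Lemma sup_nonneg (A : set R) : (forall x, A x -> 0 <= x) -> 0 <= sup A.
Proof.
move=> A0; have [hA|/sup_out->//] := pselect (has_sup A).
case: (hA) => -[x Ax] ubA; apply: le_trans (A0 _ Ax) _.
exact: ub_le_sup.
Qed.

Lemma max_along_ge0 (xi : R -> plane R) (F : plane R -> R) :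
  (forall p, 0 <= F p) -> 0 <= max_along xi F.
Proof. by move=> F0; apply: sup_nonneg => _ [t _ <-]. Qed.

Variables (vbar W : R) (w : plane R -> plane R).
Hypothesis vbar_gt0 : 0 < vbar.
Hypothesis w_le : forall p, enorm (w p) <= W.
Hypothesis W_lt : W < vbar.

Lemma alpha0_ge0 (L : R) p : 0 <= L -> 0 <= alpha0 vbar w L p.
Proof.
move=> L0; have c20 : 0 <= c2 w p.
  by apply: sup_nonneg => _ [u _ <-]; exact: enorm_ge0.
rewrite /alpha0 mulr_ge0// ?divr_ge0// ?exprn_ge0// ?sqrtr_ge0//.
by rewrite addr_ge0// mulr_ge0// ?sqr_ge0// mulr_ge0// sqrtr_ge0.
Qed.

Lemma alpha1_ge0 p : 0 <= alpha1 vbar w p.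
Proof.
have c10 : 0 <= c1 w p by apply: sup_nonneg => _ [u _ <-]; exact: enorm_ge0.
by rewrite /alpha1 divr_ge0 ?sqr_ge0// mulr_ge0.
Qed.

(** Each value of [alpha2] is at least 2 / (L vbar), as [vlow] is at most [vbar]. The supremum
    inherits this once [alpha2] is bounded above, which the gap between [W] and [vbar] provides. *)
Lemma max_along_alpha2_ge (L : R) xi : 0 < L ->
  2 / (L * vbar) <= max_along xi (alpha2 vbar w L).
Proof.
move=> L0; have W0 : 0 <= W by apply: le_trans (enorm_ge0 _) (w_le 0).
pose vm := Num.sqrt (vbar ^+ 2 - W ^+ 2).
have d0 : 0 < vbar ^+ 2 - W ^+ 2.
  by rewrite subr_gt0 ltr_sqr ?nnegrE// ltW.
have vm0 : 0 < vm by rewrite sqrtr_gt0.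
have vlo p : vm <= vlow vbar w p.
  rewrite ler_wsqrtr// lerB// ler_sqr ?nnegrE ?enorm_ge0//; exact: w_le.
have vhi p : vlow vbar w p <= vbar.
  rewrite -[leRHS](ger0_norm (ltW vbar_gt0)) -sqrtr_sqr ler_wsqrtr//.
  by rewrite lerBlDr lerDl sqr_ge0.
have v0 p : 0 < vlow vbar w p by exact: lt_le_trans (vlo p).
have a2 p : 2 / (L * vbar) <= alpha2 vbar w L p.
  by rewrite /alpha2 ler_pM2l// lef_pV2 ?posrE ?mulr_gt0// ler_pM2l.
apply: le_trans (a2 (xi 0)) _; apply: ub_le_sup.
  exists (2 / (L * vm)) => _ [t _ <-].
  by rewrite /alpha2 ler_pM2l// lef_pV2 ?posrE ?mulr_gt0// ler_pM2l.
by exists 0 => //; apply/unit_itvP; rewrite lexx ler01.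
Qed.

Lemma wind_bound : (sup_norm w < vbar%:E)%E ->
  exists2 W' : R, W' < vbar & forall p, enorm (w p) <= W'.
Proof.
move=> hw; have ub p : ((enorm (w p))%:E <= sup_norm w)%E.
  by apply: ereal_sup_ubound; exists p.
have fn : sup_norm w \is a fin_num.
  rewrite ge0_fin_numE; first exact: lt_trans hw (ltry _).
  by apply: le_trans (ub 0); rewrite lee_fin enorm_ge0.
exists (fine (sup_norm w)); first by rewrite -lte_fin fineK.
by move=> p; rewrite -lee_fin fineK.
Qed.

End Coefficients.

Section GlobalOptimality.
Context {R : realType}.
Variables (xO xD : plane R) (vbar W : R) (w : plane R -> plane R).
Variables (Omega : set (plane R)) (xiC : R -> plane R).
Hypothesis xO_neq_xD : xO <> xD.
Hypothesis vbar_gt0 : 0 < vbar.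
Hypothesis w_C2 : twice_continuously_differentiable w.
Hypothesis w_le : forall p, enorm (w p) <= W.
Hypothesis W_lt : W < vbar.
Hypothesis Omega_ellipse : filled_ellipse xO xD Omega.
Hypothesis Omega_optimal : forall xi,
  is_minimizer (flight_duration vbar w) (trajectories xO xD setT) xi ->
  forall t, unit_itv t -> Omega (xi t).
Hypothesis xiC_min : is_minimizer (flight_duration vbar w)
  (constant_speed_trajectories xO xD Omega) xiC.

(* A global minimizer exists and lies in [Omega], where it is approximated by
   inscribed polygons, which do have a constant-speed parametrization. *)
Lemma minimizer_is_global y : trajectories xO xD setT y ->
  flight_duration vbar w xiC <= flight_duration vbar w y.
Proof.
case: xiC_min => -[[xiO xilip xi0 xi1] _] xiC_le.
have xiT : trajectories xO xD setT xiC by split.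
have [C [T [x [C0 T0 hx xmin Tmin]]]] :=
  global_minimizer vbar_gt0 w_le W_lt (C2_continuous w_C2) (C2_lipschitz w_C2) xiT.
move=> /Tmin; apply: le_trans.
have xO_ t : 0 <= t <= 1 -> Omega (x t).
  by move=> t01; apply: (Omega_optimal xmin); exact/unit_itvP.
have [_ _ x0 x1] := xmin.1.
have [rho hrho] := ellipse_bounded Omega_ellipse.
have [K K0 hK] := C2_lipschitz w_C2 rho.
pose E := (C + 2 * vbar * K * T ^+ 2) / (vbar - W).
have h (n : nat) : flight_duration vbar w xiC <= T + E / n.+1%:R.
  have [|Y hY hT] := @inscribed_polygon R vbar W w vbar_gt0 w_le W_lt
    (C2_continuous w_C2) Omega C T K xO xD x n C0 T0 K0 xO_neq_xD
    (ellipse_convex Omega_ellipse) _ hx x0 x1 xO_.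
    by move=> a b ha hb; apply: hK; exact: hrho.
  exact: le_trans (xiC_le _ hY) hT.
apply/ler_addgt0Pr => e e0.
have [n hn] : exists n : nat, E / n.+1%:R <= e.
  exists (Num.truncn (`|E| / e)); rewrite ler_pdivrMr// mulrC -ler_pdivrMr//.
  apply: (@le_trans _ _ (`|E| / e)); first by rewrite ler_pM2r ?invr_gt0// ler_norm.
  exact/ltW/truncnS_gt.
by apply: le_trans (h n) _; rewrite lerD2l.
Qed.

End GlobalOptimality.

(* The signs follow the iterated [lipschitz_fun_lin] and [is_derive_lin]. *)
Lemma duration_gap (R : realFieldType) (a b d c : R) : d <= b ->
  a - -1 * b - 2 * d - c * 1 <= 0 - -1 * 0 - 2 * 0 - c * 0 -> a - d <= c.
Proof. lra. Qed.

Lemma rate_gap (R : realFieldType) (a b d c : R) :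
  a + b - 2 * d <= c -> a - -1 * b - 2 * d - c * 1 <= 0.
Proof. lra. Qed.

(** * Comparison of the optimal path with a discrete path *)

Section MainEstimate.
Context {R : realType}.
Variables (xO xD : plane R) (vbar W : R) (w : plane R -> plane R).
Variables (Omega : set (plane R)) (xi : R -> plane R) (sigma L : R).
Hypothesis xO_neq_xD : xO <> xD.
Hypothesis vbar_gt0 : 0 < vbar.
Hypothesis w_C2 : twice_continuously_differentiable w.
Hypothesis w_le : forall p, enorm (w p) <= W.
Hypothesis W_lt : W < vbar.
Hypothesis Omega_ellipse : filled_ellipse xO xD Omega.
Hypothesis w_Omega : forall p, Omega p -> enorm (w p) <= 9 / 20 * vbar.
Hypothesis xi_traj : trajectories xO xD Omega xi.
Hypothesis xi_global : forall y, trajectories xO xD setT y ->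
  flight_duration vbar w xi <= flight_duration vbar w y.
Hypothesis xi_curvature : bounded_curvature sigma xi.
Hypothesis xi_speed : has_speed xi L.

Let w_lt p : enorm (w p) < vbar.
Proof. exact: le_lt_trans W_lt. Qed.

Let xi_der (t : R) : 0 < t < 1 -> is_derive t 1 xi (path_deriv xi t).
Proof.
move=> t01; apply: is_derive_path_deriv => //; apply: xi_curvature.1.
by apply/unit_itvP; case/andP: t01 => t0 t1; rewrite !ltW.
Qed.

(** The maximum with 0 is taken because positivity of [L] is itself derived from this bound, in
    [speed_gt0]. *)
Let xi_incr (a b : R) : 0 <= a -> a <= b -> b <= 1 ->
  enorm (xi b - xi a) <= Num.max L 0 * (b - a).
Proof.
move=> a0 ab b1; have [_ [k xik] _ _] := xi_traj.
have M0 : 0 <= Num.max L 0 by rewrite le_max lexx orbT.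
have := @path_increment R k (Num.max L 0) a b xi 0 xik a0 ab b1.
rewrite scaler0 subr0; apply => //.
apply: ae_imp xi_speed => t ht /andP[at_ tb].
have t01 : 0 < t < 1 by rewrite (le_lt_trans a0)//= (lt_le_trans tb).
exists (path_deriv xi t); first exact: xi_der.
rewrite subr0 ht ?le_max ?lexx//.
by apply/unit_itvP; case/andP: t01 => t0 t1; rewrite !ltW.
Qed.

Lemma speed_gt0 : 0 < L.
Proof.
have [_ _ xi0 xi1] := xi_traj.
have := xi_incr (lexx 0) ler01 (lexx 1); rewrite xi0 xi1 subr0 mulr1 => h.
have : 0 < Num.max L 0.
  apply: lt_le_trans h; rewrite lt_def enorm_ge0 andbT; apply/eqP => /enorm_eq0 /eqP.
  by rewrite subr_eq0 => /eqP E; apply: xO_neq_xD.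
by rewrite lt_max ltxx orbF.
Qed.

Let L_gt0 := speed_gt0.

Let xi_lip (a b : R) : 0 <= a -> a <= b -> b <= 1 ->
  enorm (xi b - xi a) <= L * (b - a).
Proof.
by move=> a0 ab b1; have := xi_incr a0 ab b1; rewrite max_l// ltW.
Qed.

Hypothesis sigma_gt0 : 0 < sigma.

Section Estimate.
Variables (n : nat) (v : nat -> plane R) (h eta : R).
Hypothesis n_gt0 : (0 < n)%N.
Let N : R := n%:R.
Hypothesis eta_gt0 : 0 < eta.
Hypothesis n_lo : N^-1 <= eta.
Hypothesis n_hi : N * eta <= 1 + eta.
Hypothesis h_ge0 : 0 <= h.
Hypothesis h_le : h <= sigma * eta ^+ 2.
Hypothesis v_near : forall i, (i <= n)%N -> enorm (xi (i%:R / N) - v i) <= h.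

Let N_gt0 : 0 < N. Proof. by rewrite ltr0n. Qed.

Let step (i : nat) : i.+1%:R / N - i%:R / N = N^-1 :> R.
Proof. by rewrite -mulrBl -natr1 [_ + 1]addrC addrK mul1r. Qed.

Let grid01 (i : nat) : (i < n)%N -> [/\ 0 <= i%:R / N :> R,
  i%:R / N <= i.+1%:R / N :> R & i.+1%:R / N <= 1 :> R].
Proof.
move=> ni; split; first by rewrite divr_ge0// ltW.
  by rewrite ler_pM2r ?invr_gt0// ler_nat.
by rewrite ler_pdivrMr// mul1r ler_nat.
Qed.

(** A chord of the optimal path plus one vertex error at either end; with L / N <= l this is the
    range in which a dense graph has all edges. *)
Lemma node_step i : (i < n)%N -> enorm (v i.+1 - v i) <= L / N + 2 * h.
Proof.
move=> ni; have [g0 g1 g2] := grid01 ni.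
have := xi_lip g0 g1 g2; rewrite step => h1.
have h2 := v_near ni; have h3 := v_near (ltnW ni).
have -> : v i.+1 - v i = - (xi (i.+1%:R / N) - v i.+1) +
    ((xi (i.+1%:R / N) - xi (i%:R / N)) + (xi (i%:R / N) - v i)).
  by apply/rowP => j; rewrite !mxE; ring.
apply: le_trans (enormD _ _) _; rewrite enormN.
have := enormD (xi (i.+1%:R / N) - xi (i%:R / N)) (xi (i%:R / N) - v i).
by move: h1 h2 h3; lra.
Qed.

Let xi_taylor (a b t : R) : 0 <= a -> a <= b -> b <= 1 -> b - a <= N^-1 ->
  a <= t <= a + N^-1 -> b <= a + N^-1 -> 0 < t < 1 ->
  enorm (xi b - xi a - (b - a) *: path_deriv xi t) <= sigma * eta * (b - a).
Proof.
move=> a0 ab b1 baN /andP[at_ tN] bN t01; have [_ [k xik] _ _] := xi_traj.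
apply: (path_increment xik) => //; last by rewrite mulr_ge0// ltW.
apply: aeW => s /andP[as_ sb].
have s01 : 0 < s < 1 by rewrite (le_lt_trans a0)//= (lt_le_trans sb).
exists (path_deriv xi s); first exact: xi_der.
have su : unit_itv s by apply/unit_itvP; case/andP: s01 => s0 s1; rewrite !ltW.
have tu : unit_itv t by apply/unit_itvP; case/andP: t01 => s0 s1; rewrite !ltW.
apply: le_trans (xi_curvature.2 _ _ su tu) _.
rewrite ler_pM2l// (le_trans _ n_lo)// ler_norml.
by move: as_ sb at_ tN bN; lra.
Qed.

(** In the derivative, curvature over one step contributes sigma eta, and the vertex errors
    contribute 2 N h <= 2 sigma eta (1 + eta). The 7 in the position is 1 for [h], 5 for the
    derivative error over the step, and 1 for the Taylor error. *)
Lemma interpolant_deviation i (t : R) (q1 := N *: (v i.+1 - v i)) :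
  (i < n)%N -> i%:R / N < t -> t < i.+1%:R / N -> eta <= 1 ->
  enorm (q1 - path_deriv xi t) <= sigma * (3 * eta + 2 * eta ^+ 2) /\
  enorm (interpolant n v t - xi t) <= 7 * sigma * eta ^+ 2.
Proof.
move=> ni ti ti1 eta1; have [g0 g1 g2] := grid01 ni.
have t01 : 0 < t < 1 by rewrite (le_lt_trans g0)//= (lt_le_trans ti1).
set q := path_deriv xi t; pose ti0 : R := i%:R / N.
have ti1E : i.+1%:R / N = ti0 + N^-1 by have := step i; rewrite -/ti0; lra.
have hv0 := v_near (ltnW ni); have hv1 := v_near ni.
have hA : enorm (xi (i.+1%:R / N) - xi ti0 - N^-1 *: q) <= sigma * eta * N^-1.
  have := @xi_taylor ti0 (i.+1%:R / N) t g0 g1 g2; rewrite step; apply => //.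
  - by rewrite (ltW ti)/= -ti1E ltW.
  - by rewrite ti1E.
have hB : enorm (xi t - xi ti0 - (t - ti0) *: q) <= sigma * eta * (t - ti0).
  apply: xi_taylor => //; [exact: ltW|by case/andP: t01 => _ /ltW| | |].
  - by rewrite lerBlDl -ti1E ltW.
  - by rewrite (ltW ti)/= -ti1E ltW.
  - by rewrite -ti1E ltW.
have hd : enorm (q1 - q) <= sigma * (3 * eta + 2 * eta ^+ 2).
  have -> : q1 - q = N *: ((xi (i.+1%:R / N) - xi ti0 - N^-1 *: q) +
     ((xi ti0 - v i) + - (xi (i.+1%:R / N) - v i.+1))).
    by apply/rowP => j; rewrite !mxE; field; rewrite gt_eqF.
  rewrite enormZ (gtr0_norm N_gt0).
  have h1 : enorm ((xi (i.+1%:R / N) - xi ti0 - N^-1 *: q) +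
     ((xi ti0 - v i) + - (xi (i.+1%:R / N) - v i.+1))) <= sigma * eta * N^-1 + 2 * h.
    apply: le_trans (enormD _ _) _; have := enormBD (xi ti0 - v i) (xi (i.+1%:R / N) - v i.+1).
    by move: hA hv0 hv1; rewrite -/ti0; lra.
  apply: le_trans (ler_wpM2l (ltW N_gt0) h1) _.
  have -> : N * (sigma * eta * N^-1 + 2 * h) = sigma * eta + 2 * (N * h).
    by field; rewrite gt_eqF.
  have h2 : N * h <= sigma * eta * (1 + eta).
    apply: le_trans (ler_wpM2l (ltW N_gt0) h_le) _.
    have -> : N * (sigma * eta ^+ 2) = sigma * eta * (N * eta) by ring.
    by rewrite ler_wpM2l// mulr_ge0// ltW.
  by move: h2; lra.
split => //.
have tt : 0 <= t - ti0 <= eta.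
  rewrite subr_ge0 (ltW ti)/=; apply: le_trans n_lo.
  by rewrite lerBlDl -ti1E ltW.
rewrite (interpolantE v n_gt0 (ltW ti) (ltW ti1)) -/N -/ti0 -/q1.
have -> : v i + (t - ti0) *: q1 - xi t = (- (xi ti0 - v i) + (t - ti0) *: (q1 - q))
    + - (xi t - xi ti0 - (t - ti0) *: q).
  by apply/rowP => j; rewrite !mxE; ring.
apply: le_trans (enormD _ _) _; rewrite enormN.
have := enormD (- (xi ti0 - v i)) ((t - ti0) *: (q1 - q)).
rewrite enormN enormZ; case/andP: tt => tt0 tt1; rewrite (ger0_norm tt0) => h3.
have h4 : (t - ti0) * enorm (q1 - q) <= eta * (sigma * (3 * eta + 2 * eta ^+ 2)).
  by apply: ler_pM => //; exact: enorm_ge0.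
have h5 : sigma * eta * (t - ti0) <= sigma * eta * eta.
  by rewrite ler_wpM2l// mulr_ge0// ltW.
have h6 : sigma * eta ^+ 2 * eta <= sigma * eta ^+ 2.
  by rewrite ler_piMr// mulr_ge0 ?sqr_ge0// ltW.
rewrite -/ti0 in hv0.
by move: h3 h4 h5 h6 hB hv0 h_le; lra.
Qed.

End Estimate.

(* [xi_global] is applied to the reflection [2 xi - xt] of the polygon [xt],
   so that only a second difference of the travel density remains. *)
Lemma graph_error : exists2 eta0 : R, 0 < eta0 &
  forall (G : digraph xO xD) (h l : R), dense_in h l Omega G -> 0 < l ->
    l / L <= eta0 -> l / L <= 1 -> h <= sigma * (l / L) ^+ 2 ->
    forall xiG, is_minimizer (flight_duration vbar w) (discrete_paths G) xiG ->
      flight_duration vbar w xiG - flight_duration vbar w xi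
        <= 184 / 3 * sigma ^+ 2 / (L * vbar) * (l / L) ^+ 2.
Proof.
have [rho hrho] := ellipse_bounded Omega_ellipse.
have [K K0 hK] := C2_lipschitz w_C2 (rho + 7 * sigma).
have [K2 K20 hK2] := C2_second_difference w_C2 (rho + 7 * sigma).
have s0 := ltW sigma_gt0.
have [||eta0 eta00 heta0] := @density_second_difference_small R vbar w vbar_gt0 w_lt
  L sigma (K * (7 * sigma)) (K2 * (7 * sigma) ^+ 2) L_gt0 sigma_gt0.
- by rewrite !mulr_ge0.
- by rewrite mulr_ge0// sqr_ge0.
exists eta0 => // G h l [h0 _ VO near edge] l0.
set eta := l / L => e0 e1 hle xiG [_ xiG_min].
have eta_gt0 : 0 < eta by rewrite divr_gt0.
have [xiO [k xik] xi0 xi1] := xi_traj.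
(* Then 1 / eta < n <= 1 / eta + 1, whence [n_lo] and [n_hi]. *)
pose n := (Num.truncn eta^-1).+1; pose N : R := n%:R.
have n_gt0 : (0 < n)%N by [].
have N_gt0 : 0 < N by rewrite ltr0n.
have eV : 0 < eta^-1 by rewrite invr_gt0.
have n_lo : N^-1 <= eta.
  by rewrite -[leRHS]invrK lef_pV2 ?posrE//; exact/ltW/truncnS_gt.
have n_hi : N * eta <= 1 + eta.
  rewrite -ler_pdivlMr// mulrDl mul1r divff ?gt_eqF// /N -natr1 lerD2r.
  by rewrite truncn_le// ltW.
have [u hu] : exists u : nat -> plane R, forall i, (i <= n)%N ->
    vertices G (u i) /\ enorm (xi (i%:R / N) - u i) <= h.
  suff : forall i, exists z : plane R, (i <= n)%N ->
      vertices G z /\ enorm (xi (i%:R / N) - z) <= h.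
    by move=> /choice[u hu]; exists u.
  move=> i; have [ni|] := boolP (i <= n)%N; last by exists 0.
  have [|z z1 z2] := near (xi (i%:R / N)); last by exists z.
  apply: xiO; apply/unit_itvP.
  by rewrite divr_ge0 ?(ltW N_gt0)//= ler_pdivrMr// mul1r ler_nat.
(* The vertices chosen near the ends of the path may differ from [xO] and [xD], which a discrete
   path must meet exactly. *)
pose v i := if i == 0%N then xO else if i == n then xD else u i.
have v0 : v 0%N = xO by [].
have vn : v n = xD by rewrite /v eqxx.
have v_vert i : (i <= n)%N -> vertices G (v i).
  move=> ni; rewrite /v; case: ifP => _; first exact: vertices_origin.
  by case: ifP => _; [exact: vertices_destination|have [] := hu i ni].
have v_near i : (i <= n)%N -> enorm (xi (i%:R / N) - v i) <= h.
  move=> ni; rewrite /v; case: ifP => [/eqP->|_].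
    by rewrite mul0r xi0 subrr enorm0.
  case: ifP => [/eqP->|_]; last by have [] := hu i ni.
  by rewrite divff ?gt_eqF// xi1 subrr enorm0.
have v_step i : (i < n)%N -> enorm (v i.+1 - v i) <= l + 2 * h.
  move=> ni; apply: le_trans (node_step n_gt0 v_near ni) _.
  rewrite lerD2r -/N; apply: le_trans (ler_wpM2l (ltW L_gt0) n_lo) _.
  by rewrite /eta mulrC divfK// gt_eqF.
pose xt := interpolant n v.
have xtG : discrete_paths G xt.
  exists n, v; split => //; split => //.
  by move=> i ni; apply: edge; [exact/v_vert/ltnW|exact: v_vert|rewrite enormB; exact: v_step].
apply: (@le_trans _ _ (flight_duration vbar w xt - flight_duration vbar w xi)).
  by rewrite lerD2r; exact: xiG_min.
have xt_lip : lipschitz_path (N * (l + 2 * h)) xt by exact: interpolant_lipschitz.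
pose y t := 2 *: xi t - xt t.
have y_lip : lipschitz_path (2 * k + N * (l + 2 * h)) y.
  move=> a b a1 b1; rewrite /y.
  have -> : 2 *: xi a - xt a - (2 *: xi b - xt b) = 2 *: (xi a - xi b) + - (xt a - xt b).
    by apply/rowP => j; rewrite !mxE; ring.
  apply: le_trans (enormD _ _) _; rewrite enormN (enormZ 2) ger0_norm//.
  have -> : (2 * k + N * (l + 2 * h)) * `|a - b| =
    2 * (k * `|a - b|) + N * (l + 2 * h) * `|a - b| by ring.
  by apply: lerD; [rewrite ler_pM2l//; exact: xik|exact: xt_lip].
have xt0 : xt 0 = xO by have := interpolant_node v n_gt0 0; rewrite mul0r v0.
have xt1 : xt 1 = xD.
  by have := interpolant_node v n_gt0 n; rewrite divff ?gt_eqF// vn.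
have y_traj : trajectories xO xD setT y.
  split => //; first by exists (2 * k + N * (l + 2 * h)).
  - by rewrite /y xt0 xi0 scaler_nat mulr2n addrK.
  - by rewrite /y xt1 xi1 scaler_nat mulr2n addrK.
have opt := xi_global y_traj.
have [K' [tau1 [l1 t10 t11 h1]]] := clock vbar_gt0 w_le W_lt (C2_continuous w_C2) xt_lip.
have [K3 [tau2 [l2 t20 t21 h2]]] := clock vbar_gt0 w_le W_lt (C2_continuous w_C2) y_lip.
have [K4 [tau3 [l3 t30 t31 h3]]] := clock vbar_gt0 w_le W_lt (C2_continuous w_C2) xik.
set c := 184 / 3 * sigma ^+ 2 / (L * vbar) * eta ^+ 2.
(* Its derivative is almost everywhere the second difference of the travel density minus [c]. *)
pose f t := tau1 t - (-1) * tau2 t - 2 * tau3 t - c * idfun t.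
have id_lip : lipschitz_fun 1 (@idfun R) by move=> s t _ _; rewrite mul1r.
have := @lipschitz_nonincreasing R _ f 0 1 (lipschitz_fun_lin c (lipschitz_fun_lin 2
  (lipschitz_fun_lin (-1) l1 l2) l3) id_lip).
rewrite /f t10 t20 t30 t11 t21 t31 /= => hf.
apply: (duration_gap opt).
apply: hf => //.
apply: ae_imp (ae_and (ae_notin [seq i%:R / N | i <- iota 0 n.+1])
  (ae_and xi_speed (ae_and h1 (ae_and h2 h3)))) => t [tn [hs [k1 [k2 k3]]]] t01.
have [i [ni ti ti1]] := grid_piece n_gt0 t01 tn.
have tu : unit_itv t by apply/unit_itvP; case/andP: t01 => t0 t1; rewrite !ltW.
have [d1 e1'] := k1 t01; have [d2 e2] := k2 t01; have [d3 e3] := k3 t01.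
have der_xt := interpolant_is_derive v n_gt0 ti ti1.
set q1 := _ *: _ in der_xt.
rewrite (path_deriv_is_derive t01 der_xt) in e1'.
have der_y : is_derive t 1 y (2 *: path_deriv xi t - q1).
  have := is_deriveB (is_deriveZ 2 d3) der_xt; exact.
rewrite (path_deriv_is_derive t01 der_y) in e2.
have id_der : is_derive t 1 (@idfun R) (1 : R) by exact: is_derive_id.
have := is_derive_lin c (is_derive_lin 2 (is_derive_lin (-1) e1' e2) e3) id_der.
set D := (X in is_derive _ _ _ X) => hD; exists D; first exact: hD.
have [dev1 dev2] := interpolant_deviation n_gt0 eta_gt0 n_lo n_hi hle v_near ni ti ti1 e1.
have Ot : Omega (xi t) by exact: xiO.
have := heta0 eta (xi t) (path_deriv xi t) (xt t) (y t) (q1 - path_deriv xi t).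
rewrite [path_deriv xi t + _]addrC subrK.
have -> : path_deriv xi t - (q1 - path_deriv xi t) = 2 *: path_deriv xi t - q1.
  by apply/rowP => j; rewrite !mxE; ring.
rewrite eta_gt0 e0 => /(_ isT e1 (hs tu) (w_Omega Ot)).
pose dl := xt t - xi t.
have dlle : enorm dl <= 7 * sigma * eta ^+ 2 by exact: dev2.
have e2e : eta ^+ 2 <= eta by rewrite expr2 ler_piMl// ltW.
have dls : enorm dl <= 7 * sigma.
  apply: le_trans dlle _; rewrite ler_piMr//; first by rewrite mulr_ge0.
  exact: le_trans e2e e1.
have xtE : xt t = xi t + dl by rewrite /dl addrC subrK.
have yE : y t = xi t - dl by apply/rowP => j; rewrite /y /dl !mxE; ring.
have xiB : enorm (xi t) + enorm dl <= rho + 7 * sigma by apply: lerD; [exact: hrho|].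
have w1 : enorm (w (xt t) - w (y t)) <= 2 * (K * (7 * sigma)) * eta ^+ 2.
  apply: le_trans (hK _ _ _ _) _.
  - by rewrite xtE; apply: le_trans (enormD _ _) _.
  - by rewrite yE; apply: le_trans (enormBD _ _) _.
  have -> : xt t - y t = 2 *: dl by apply/rowP => j; rewrite xtE yE !mxE; ring.
  rewrite enormZ ger0_norm//.
  have -> : 2 * (K * (7 * sigma)) * eta ^+ 2 = K * (2 * (7 * sigma * eta ^+ 2)) by ring.
  by rewrite ler_wpM2l// ler_pM2l.
have w2 : enorm (w (xt t) + w (y t) - 2 *: w (xi t)) <= 2 * (K2 * (7 * sigma) ^+ 2) * eta ^+ 3.
  rewrite xtE yE; apply: le_trans (hK2 _ _ xiB) _.
  have d2le : enorm dl ^+ 2 <= (7 * sigma * eta ^+ 2) ^+ 2.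
    rewrite ler_sqr ?nnegrE ?enorm_ge0//.
    by apply: le_trans dlle; exact: enorm_ge0.
  apply: le_trans (ler_wpM2l K20 d2le) _.
  (* The second difference of the wind is of order eta^4; one factor eta <= 1 is given away to reach
     the required eta^3. *)
  have -> : K2 * (7 * sigma * eta ^+ 2) ^+ 2 = K2 * (7 * sigma) ^+ 2 * eta ^+ 3 * eta by ring.
  have z0 : 0 <= K2 * (7 * sigma) ^+ 2 * eta ^+ 3.
    by apply: mulr_ge0; [apply: mulr_ge0 => //; exact: sqr_ge0|apply: exprn_ge0; exact: ltW].
  apply: le_trans (ler_piMr z0 e1) _.
  by rewrite -(mulrA 2) ler_peMl// ler1n.
move=> /(_ w1 w2 dev1); rewrite -/c /D.
exact: rate_gap.
Qed.

End MainEstimate.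

Theorem theorem5 (R : realType) (xO xD : plane R) (vbar : R)
    (w : plane R -> plane R) (Omega : set (plane R))
    (xiC : R -> plane R) (sigma L : R)
    (xO_neq_xD : xO <> xD)
    (vbar_gt0 : 0 < vbar)
    (w_C2 : twice_continuously_differentiable w)
    (w_lt_vbar : (sup_norm w < vbar%:E)%E)
    (Omega_ellipse : filled_ellipse xO xD Omega)
    (Omega_optimal : forall xi,
      is_minimizer (flight_duration vbar w) (trajectories xO xD setT) xi ->
      forall t, unit_itv t -> Omega (xi t))
    (w_le : forall p, Omega p -> enorm (w p) <= vbar / Num.sqrt 5)
    (xiC_min : is_minimizer (flight_duration vbar w)
      (constant_speed_trajectories xO xD Omega) xiC)
    (xiC_curvature : bounded_curvature sigma xiC)
    (xiC_speed : has_speed xiC L) :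
  let a0 := max_along xiC (alpha0 vbar w L) in
  let a1 := max_along xiC (alpha1 vbar w) in
  let a2 := max_along xiC (alpha2 vbar w L) in
  (exists2 r : R, 0 < r &
    forall (G : digraph xO xD) (h l : R),
      dense_in h l Omega G ->
      (l%:E <= mine (curvature_ratio r sigma) 1 * L%:E)%E ->
      h <= sigma * l ^+ 2 / L ^+ 2 ->
      forall xiG,
        is_minimizer (flight_duration vbar w) (discrete_paths G) xiG ->
        flight_duration vbar w xiG - flight_duration vbar w xiC
          <= error_bound sigma L a0 a1 a2 l) /\
  (exists2 g : R -> R, g =O_ (0^'+) (fun l => l ^+ 3) &
    \forall l \near 0^'+,
      error_bound sigma L a0 a1 a2 l
        <= 92 * sigma ^+ 2 * a2 / (3 * L ^+ 2) * l ^+ 2 + g l).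
Proof.
move=> a0 a1 a2.
have [W W_lt w_leW] := wind_bound w_lt_vbar.
have xiT := xiC_min.1.1.
have glob := minimizer_is_global xO_neq_xD vbar_gt0 w_C2 w_leW W_lt Omega_ellipse
  Omega_optimal xiC_min.
have w_Omega p : Omega p -> enorm (w p) <= 9 / 20 * vbar.
  move=> /w_le hp; apply: le_trans hp _; rewrite mulrC ler_pM2r//.
  have s5 : (20 / 9 : R) <= Num.sqrt 5.
    have c0 : 0 <= 20 / 9 :> R by lra.
    rewrite -[leLHS](ger0_norm c0) -sqrtr_sqr ler_wsqrtr//; lra.
  have c9 : 0 < 9 / 20 :> R by lra.
  rewrite -[leRHS]invrK lef_pV2 ?posrE ?invr_gt0 ?sqrtr_gt0//; lra.
have L_gt0 : 0 < L := speed_gt0 xO_neq_xD xiT xiC_curvature xiC_speed.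
have sigma_ge0 : 0 <= sigma by exact: lipschitz_path_ge0 xiC_curvature.2.
have a0_ge0 : 0 <= a0 by apply: max_along_ge0 => p; apply: alpha0_ge0; exact: ltW.
have a1_ge0 : 0 <= a1 by apply: max_along_ge0 => p; exact: alpha1_ge0.
have a2_ge : 2 / (L * vbar) <= a2 by exact: (max_along_alpha2_ge vbar_gt0 w_leW W_lt).
have no_dense0 (G : digraph xO xD) (h l : R) : dense_in h l Omega G -> h <= 0 -> False.
  move=> [h0 _ VO near _] h0'; apply: (ellipse_infinite Omega_ellipse xO_neq_xD).
  apply: sub_finite_set (vertices_finite G) => x /near[v vG xv].
  have /eqP : enorm (x - v) = 0.
    by apply/eqP; rewrite eq_le enorm_ge0 andbT; exact: le_trans xv h0'.
  by move=> /eqP /enorm_eq0 /eqP; rewrite subr_eq0 => /eqP ->.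
split.
  have [sigma0|sigma_neq0] := eqVneq sigma 0.
    exists 1 => // G h l Gd _ hle; exfalso; apply: (no_dense0 _ _ _ Gd).
    by move: hle; rewrite sigma0 !mul0r.
  have sigma_gt0 : 0 < sigma by rewrite lt_def sigma_neq0.
  have [eta0 eta0_gt0 main] := graph_error xO_neq_xD vbar_gt0 w_C2 w_leW W_lt
    Omega_ellipse w_Omega xiT glob xiC_curvature xiC_speed sigma_gt0.
  (* The factor 7 sigma cancels the one in [curvature_ratio], so that the hypothesis on [l] reads l
     / L <= min(eta0, 1). *)
  exists (7 * sigma * eta0); first by rewrite !mulr_gt0.
  move=> G h l Gd + hle xiG xiGmin.
  have -> : (curvature_ratio (7 * sigma * eta0) sigma = eta0%:E)%E.
    by rewrite /curvature_ratio (negPf sigma_neq0) mulrC mulKf// mulf_neq0.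
  rewrite -EFin_min -EFinM lee_fin -ler_pdivrMr// le_min => /andP[le0 le1].
  have [_ l_ge0 _ _ _] := Gd.
  have [l0|l_neq0] := eqVneq l 0.
    exfalso; apply: (no_dense0 _ _ _ Gd); apply: le_trans hle _.
    by rewrite l0 expr0n/= mulr0 mul0r.
  have l_gt0 : 0 < l by rewrite lt_def l_neq0.
  have hle' : h <= sigma * (l / L) ^+ 2 by rewrite exprMn exprVn mulrA.
  apply: le_trans (main G h l Gd l_gt0 le0 le1 hle' xiG xiGmin) _.
  have eta_ge0 : 0 <= l / L by exact: divr_ge0 l_ge0 (ltW L_gt0).
  have -> : error_bound sigma L a0 a1 a2 l = 4 / 3 * (sigma * (l / L)) ^+ 2
      * ((l / L) ^+ 2 * a0 + 5 * (l / L) * a1 + 23 * a2).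
    by rewrite /error_bound; field; rewrite gt_eqF.
  (* The estimate of [graph_error] is the [a2] term of the bound with [a2] replaced by its lower
     bound 2 / (L vbar); the other two terms are nonnegative. *)
  have -> : 184 / 3 * sigma ^+ 2 / (L * vbar) * (l / L) ^+ 2 =
      4 / 3 * (sigma * (l / L)) ^+ 2 * (23 * (2 / (L * vbar))).
    by field; rewrite !gt_eqF.
  apply: ler_wpM2l; first by rewrite mulr_ge0 ?sqr_ge0// divr_ge0.
  rewrite -[leLHS]add0r; apply: lerD; last by rewrite ler_pM2l.
  apply: addr_ge0; first by rewrite mulr_ge0 ?sqr_ge0.
  by rewrite mulr_ge0// mulr_ge0.
(* The remainder consists of the terms with [a0] and [a1], so that the inequality holds with
   equality. *)
exists (fun l => 4 * sigma ^+ 2 / (3 * L ^+ 2)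
    * (l ^+ 2 * (l ^+ 2 / L ^+ 2 * a0 + 5 * (l / L) * a1))); last first.
  near=> l; rewrite le_eqVlt; apply/orP; left; apply/eqP.
  by rewrite /error_bound; field; rewrite gt_eqF.
(* For l <= 1 the fourth power in the [a0] term is at most l^3, so [k * l ^+ 3] bounds the
   remainder. *)
pose k := 4 * sigma ^+ 2 / (3 * L ^+ 2) * (a0 / L ^+ 2 + 5 * a1 / L).
apply/eqOP; near=> M; near=> l.
have l0 : 0 < l by near: l; exact: nbhs_right_gt.
have l1 : l <= 1 by near: l; apply: nbhs_right_le.
have c0 : 0 <= 4 * sigma ^+ 2 / (3 * L ^+ 2).
  by apply: divr_ge0; apply: mulr_ge0 => //; exact: sqr_ge0.
have i0 := ltW L_gt0.
rewrite [`|l ^+ 3|]ger0_norm ?exprn_ge0 ?(ltW l0)// ger0_norm.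
  have kM : k <= M by near: M; apply: nbhs_pinfty_ge; exact: num_real.
  apply: (@le_trans _ _ (k * l ^+ 3)); last by rewrite ler_wpM2r// exprn_ge0// ltW.
  have -> : k * l ^+ 3 = 4 * sigma ^+ 2 / (3 * L ^+ 2) *
      (l ^+ 2 * (l / L ^+ 2 * a0 + 5 * (l / L) * a1)).
    by rewrite /k; field; rewrite gt_eqF.
  rewrite !ler_wpM2l ?sqr_ge0// lerD2r ler_wpM2r// ler_wpM2r ?invr_ge0 ?sqr_ge0//.
  by rewrite expr2 ler_piMl// ltW.
have l0' := ltW l0; apply: mulr_ge0 => //; apply: mulr_ge0; first exact: sqr_ge0.
apply: addr_ge0; apply: mulr_ge0 => //; first by rewrite divr_ge0 ?sqr_ge0.
by rewrite mulr_ge0// divr_ge0.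
Unshelve. all: by end_near. Qed.
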